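(* The trace $T$-ideal $\mathrm{Id}^{tr}\big(C_2^{t_{0,1}}\big)$ is generated, as a $T^{tr}$-ideal, by the polynomials \begin{align*} f_1&=[x_1,x_2],\\ h_2&=\mathrm{Tr}(x_1)\mathrm{Tr}(x_2)x_3-\mathrm{Tr}(x_2)\mathrm{Tr}(x_3)x_1+\mathrm{Tr}(x_1x_2)\mathrm{Tr}(x_3)-\mathrm{Tr}(x_2x_3)\mathrm{Tr}(x_1),\\ h_3&=-\mathrm{Tr}(x_1x_2)x_3-\mathrm{Tr}(x_1x_3)x_2-\mathrm{Tr}(x_2x_3)x_1+\mathrm{Tr}(x_1x_2x_3)+\mathrm{Tr}(x_1)x_2x_3+\mathrm{Tr}(x_2)x_1x_3+\mathrm{Tr}(x_3)x_1x_2. \end{align*} Moreover, for every $n\ge1$, $c_n^{tr}\big(C_2^{t_{0,1}}\big)=2^{n+1}-n-1$.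
   Context: $F$ is a field of characteristic zero; all algebras are associative, unitary, over $F$. An algebra with trace is an algebra $A$ with a linear map $\mathrm{tr}\colon A\to F$ such that $\mathrm{tr}(ab)=\mathrm{tr}(ba)$ for all $a,b\in A$; $F$ is identified with $F\cdot 1_A\subseteq A$. Let $X=\{x_1,x_2,\dots\}$ and let $\mathcal M$ be the set of (nonempty) monomials in the noncommuting variables of $X$. The free algebra with trace is $F\langle X,\mathrm{Tr}\rangle\cong F\langle X\rangle\otimes F[\mathrm{Tr}(M)\mid M\in\mathcal M]$, where the $\mathrm{Tr}(M)$ are central commuting variables subject to $\mathrm{Tr}(MN)=\mathrm{Tr}(NM)$ and $\mathrm{Tr}(\mathrm{Tr}(M)N)=\mathrm{Tr}(M)\mathrm{Tr}(N)$. Its elements are called trace polynomials; the symbol $\mathrm{Tr}(1)$ does not occur. A trace polynomial is pure if all its variables appear inside traces. A trace polynomial $f(x_1,\dots,x_n,\mathrm{Tr})$ is a trace identity of $A$ if it vanishes whenever the $x_i$ are replaced by arbitrary elements of $A$ and $\mathrm{Tr}$ by $\mathrm{tr}$. $\mathrm{Id}^{tr}(A)$ is the set of all trace identities of $A$. A $T^{tr}$-ideal (trace $T$-ideal) is an ideal of $F\langle X,\mathrm{Tr}\rangle$ invariant under all endomorphisms (substitutions of the variables by linear combinations, with coefficients in $F[\mathrm{Tr}(M)\mid M\in\mathcal M]$, of nonempty monomials, compatibly with $\mathrm{Tr}$) and closed under taking traces ($f\mapsto \mathrm{Tr}(fM)$ for $M\in\mathcal M$, and $f\mapsto\mathrm{Tr}(f)$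 when $f$ has no pure trace term). The $T^{tr}$-ideal generated by a set is the smallest one containing it. $[x_1,x_2]=x_1x_2-x_2x_1$. $MT_n$ is the space of multilinear trace polynomials in $x_1,\dots,x_n$, spanned by the elements $\mathrm{Tr}(x_{i_1}\cdots x_{i_a})\cdots\mathrm{Tr}(x_{j_1}\cdots x_{j_b})x_{l_1}\cdots x_{l_c}$ in which each of $x_1,\dots,x_n$ occurs exactly once. The $n$-th trace codimension is $c_n^{tr}(A)=\dim_F MT_n/(MT_n\cap\mathrm{Id}^{tr}(A))$. $C_2=\left\{\begin{pmatrix}a&b\\0&a\end{pmatrix}\mid a,b\in F\right\}$, and $C_2^{t_{\alpha,\beta}}$ is $C_2$ with the trace $t_{\alpha,\beta}\begin{pmatrix}a&b\\0&a\end{pmatrix}=\alpha a+\beta b$. *)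

(* Defs.v *)
From HB Require Import structures.
From mathcomp Require Import all_boot all_order all_algebra.
From mathcomp Require Import generic_quotient finmap ring.
From mathcomp Require Export monalg.

Set Implicit Arguments.
Unset Strict Implicit.
Unset Printing Implicit Defensive.

Import GRing.Theory.
Local Open Scope quotient_scope.
Local Open Scope ring_scope.

(* The variables X are indexed by nat, starting at 0: the index i stands for
   x_(i+1), so the variables x_1, ..., x_n are those of index < n.            *)

Definition nword : Type := {w : seq nat | w != [::]}.
HB.instance Definition _ := SubChoice.on nword.

Definition rot_eq (u v : nword) : bool :=
  [exists k : 'I_(size (val u)).+1, rot k (val u) == val v].

Lemma rot_eqP (u v : nword) :
  reflect (exists k, rot k (val u) = val v) (rot_eq u v).
Proof.
apply: (iffP existsP) => [[k /eqP <-]|[k]]; first by exists k.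
case: (ltnP k (size (val u)).+1) => [ltk <-|/ltnW lek].
  by exists (Ordinal ltk).
by rewrite rot_oversize // => <-; exists ord0; rewrite rot0.
Qed.

Lemma rot_eq_refl : reflexive rot_eq.
Proof. by move=> u; apply/rot_eqP; exists 0%N; rewrite rot0. Qed.

Lemma rot_eq_sym : symmetric rot_eq.
Proof.
suff imp u v : rot_eq u v -> rot_eq v u by move=> u v; apply/idP/idP; apply: imp.
move=> /rot_eqP[k e]; apply/rot_eqP; exists (size (val v) - k)%N.
by rewrite -e; apply: rotK.
Qed.

Lemma rot_eq_trans : transitive rot_eq.
Proof.
move=> v u w /rot_eqP[k1 e1] /rot_eqP[k2 e2]; apply/rot_eqP.
case: (leqP k1 (size (val u))) => h1; last first.
  by exists k2; rewrite -e2 -e1 (rot_oversize (ltnW h1)).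
case: (leqP k2 (size (val v))) => h2; last first.
  by exists k1; rewrite -e2 e1 (rot_oversize (ltnW h2)).
have [k ->] : exists k, val w = rot k (val u); last by exists k.
rewrite -e2 -e1 rot_add_mod //; first by eexists.
by rewrite -(size_rot k1) e1.
Qed.

Canonical rot_eq_equiv := EquivRel rot_eq rot_eq_refl rot_eq_sym rot_eq_trans.

(* Indices of the commuting variables Tr(M): nonempty words up to
   MN ~ NM, i.e. up to rotation.                                              *)
Definition cyclic_word := {eq_quot rot_eq}.
HB.instance Definition _ := Choice.on cyclic_word.
HB.instance Definition _ := EqQuotient.on cyclic_word.

(* TMonom t w stands for the basis element (\prod_z Tr(z) ^+ t z) w. *)
Record tmonom : Type := TMonom {
  traces_of : {cmonom cyclic_word};
  word_of : {fmonom nat}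
}.

Definition tmonom_pair (m : tmonom) := (traces_of m, word_of m).
Definition pair_tmonom (p : {cmonom cyclic_word} * {fmonom nat}) :=
  TMonom p.1 p.2.

Lemma tmonom_pairK : cancel tmonom_pair pair_tmonom.
Proof. by case. Qed.

(* Opaque on purpose: otherwise failing unifications between elements of
   {malg F[tmonom]} unfold the comparison of finitely supported functions and
   do not terminate in practice.                                              *)
Fact tmonom_hasDecEq : hasDecEq tmonom.
Proof. exact: (Equality.on (can_type tmonom_pairK)). Qed.
HB.instance Definition _ := tmonom_hasDecEq.
Fact tmonom_hasChoice : hasChoice tmonom.
Proof. exact: (Choice.on (can_type tmonom_pairK)). Qed.
HB.instance Definition _ := tmonom_hasChoice.

Definition tmone : tmonom := TMonom mone mone.
Definition tmmul (a b : tmonom) : tmonom :=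
  TMonom (mmul (traces_of a) (traces_of b)) (mmul (word_of a) (word_of b)).

Lemma tmmulA : associative tmmul.
Proof. by move=> a b c; rewrite /tmmul !mulmA. Qed.

Lemma tmmul1m : left_id tmone tmmul.
Proof. by case=> a b; rewrite /tmmul !mul1m. Qed.

Lemma tmmulm1 : right_id tmone tmmul.
Proof. by case=> a b; rewrite /tmmul !mulm1. Qed.

Lemma tmmul_eq1 a b : tmmul a b = tmone -> a = tmone /\ b = tmone.
Proof. by case: a b => [a1 a2] [b1 b2] [/unitm[-> ->] /unitm[-> ->]]. Qed.

HB.instance Definition _ := Choice_isMonomialDef.Build tmonom
  tmmulA tmmul1m tmmulm1 tmmul_eq1.

(* F<X, Tr> *)
Notation trace_poly F := {malg F[tmonom]}.

Definition var (F : fieldType) (i : nat) : trace_poly F :=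
  << TMonom mone (fmu i) >>.

Definition word (F : fieldType) (w : {fmonom nat}) : trace_poly F :=
  << TMonom mone w >>.

(* Tr(1) does not exist; tr_word [::] is a junk value, see Tr below. *)
Definition tr_word (F : fieldType) (w : seq nat) : trace_poly F :=
  if insub w is Some u then << TMonom (ucm (\pi_cyclic_word u)) mone >> else 0.

(* The formal trace, linear over F[Tr(M)]: since Tr(Tr(M) N) = Tr(M) Tr(N), it
   sends TMonom t w to t Tr(w). It is meaningful only on the trace polynomials
   without pure trace term; by convention it kills the pure trace terms.      *)
Definition Tr (F : fieldType) : trace_poly F -> trace_poly F :=
  mmap (in_alg (trace_poly F))
    (fun t : tmonom => << TMonom (traces_of t) mone >> * tr_word F (word_of t)).

Definition no_pure_term (F : fieldType) (f : trace_poly F) : Prop :=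
  forall t : tmonom, t \in msupp f -> word_of t != mone.

(* Evaluation x_i |-> g i, Tr |-> tau, in an F-algebra B. The trace of B is
   B-valued, F (or F[Tr(M)] when B is F<X, Tr>) being identified with its image
   in B. As tau is central and symmetric in all uses below, neither the order
   of the factors tau(_) nor the representative of a cyclic word matters.      *)
Section Evaluation.
Variables (F : fieldType) (B : lalgType F) (tau : B -> B) (g : nat -> B).

Definition eval_word (w : seq nat) : B := \prod_(i <- w) g i.

Definition eval_tmonom (t : tmonom) : B :=
  (\prod_(z <- finsupp (traces_of t))
        tau (eval_word (val (repr z))) ^+ (traces_of t z))
    * eval_word (word_of t).

Definition eval_trace_poly : trace_poly F -> B := mmap (in_alg B) eval_tmonom.
End Evaluation.

(* The endomorphism x_i |-> g i of F<X, Tr>. *)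
Definition subst (F : fieldType) (g : nat -> trace_poly F) :=
  eval_trace_poly (@Tr F) g.

Record trace_on (F : fieldType) (A : algType F) := TraceOn {
  trace_fun :> {scalar A};
  trace_funC : forall a b : A, trace_fun (a * b) = trace_fun (b * a)
}.

Definition trace_identity (F : fieldType) (A : algType F) (tr : trace_on A)
    (f : trace_poly F) : Prop :=
  forall g : nat -> A, eval_trace_poly (fun a => (tr a)%:A) g f = 0.

Record trace_T_ideal (F : fieldType) (I : trace_poly F -> Prop) : Prop :=
  TraceTIdeal {
    TI_0 : I 0;
    TI_D : forall f1 f2, I f1 -> I f2 -> I (f1 + f2);
    TI_Ml : forall h f, I f -> I (h * f);
    TI_Mr : forall h f, I f -> I (f * h);
    TI_subst : forall g : nat -> trace_poly F,
      (forall i, no_pure_term (g i)) -> forall f, I f -> I (subst g f);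
    TI_Tr_word : forall (w : {fmonom nat}) f,
      w != mone -> I f -> I (Tr (f * word F w));
    TI_Tr : forall f, no_pure_term f -> I f -> I (Tr f)
  }.

Definition trace_T_ideal_gen (F : fieldType) (S : trace_poly F -> Prop)
    (f : trace_poly F) : Prop :=
  forall I, trace_T_ideal I -> (forall h, S h -> I h) -> I f.

(* Degree of the basis element t in the i-th variable. *)
Definition deg_in (i : nat) (t : tmonom) : nat :=
  (\sum_(z <- finsupp (traces_of t)) traces_of t z * count_mem i (val (repr z))
    + count_mem i (word_of t))%N.

Definition multilinear (F : fieldType) (n : nat) (f : trace_poly F) : Prop :=
  forall t, t \in msupp f -> forall i, deg_in i t = (i < n)%N.

(* dim_F U/(U \cap W) = d, for subspaces U and W of V: U/(U \cap W) has a basis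
   of d elements.                                                             *)
Definition quotient_dim (F : fieldType) (V : lmodType F) (U W : V -> Prop)
    (d : nat) : Prop :=
  exists b : 'I_d -> V,
    [/\ forall i, U (b i),
        forall u, U u -> exists c : 'I_d -> F, W (u - \sum_i c i *: b i)
      & forall c : 'I_d -> F, W (\sum_i c i *: b i) -> forall i, c i = 0].

Definition trace_codim (F : fieldType) (A : algType F) (tr : trace_on A)
    (n d : nat) : Prop :=
  quotient_dim (@multilinear F n) (trace_identity tr) d.

Section C2.
Variable F : fieldType.

Definition C2_pred : {pred 'M[F]_2} :=
  fun M => (M 1 0 == 0) && (M 0 0 == M 1 1).

Lemma C2_subalg_closed : subalg_closed C2_pred.
Proof.
split=> [|a M N /andP[/eqP M10 /eqP M00] /andP[/eqP N10 /eqP N00]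
         |M N /andP[/eqP M10 /eqP M00] /andP[/eqP N10 /eqP N00]];
  rewrite -topredE /= /C2_pred !mxE.
- by rewrite /= !eqxx.
- by rewrite M10 N10 M00 N00 mulr0 addr0 !eqxx.
- rewrite !big_ord_recl !big_ord0 /= !addr0.
  have -> : lift ord0 ord0 = 1 :> 'I_2 by apply/val_inj.
  by rewrite M10 N10 M00 N00 !mul0r !mulr0 !addr0 !add0r !eqxx.
Qed.

HB.instance Definition _ := GRing.isSubalgClosed.Build F 'M[F]_2 C2_pred
  C2_subalg_closed.

Record C2 : predArgType := MkC2 { C2_val : 'M[F]_2; _ : C2_val \in C2_pred }.
HB.instance Definition _ := [isSub for C2_val].
HB.instance Definition _ := [Choice of C2 by <:].
HB.instance Definition _ := [SubChoice_isSubAlgebra of C2 by <:].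

Definition C2_trace_fun (alpha beta : F) (M : C2) : F :=
  alpha * val M 0 0 + beta * val M 0 1.

Lemma C2_trace_fun_scalar alpha beta : scalar (C2_trace_fun alpha beta).
Proof. by move=> a M N; rewrite /C2_trace_fun !mxE; ring. Qed.

HB.instance Definition _ alpha beta := GRing.isLinear.Build F C2 F *%R
  (C2_trace_fun alpha beta) (C2_trace_fun_scalar alpha beta).

Lemma C2_trace_funC alpha beta (M N : C2) :
  C2_trace_fun alpha beta (M * N) = C2_trace_fun alpha beta (N * M).
Proof.
have /andP[/eqP M10 /eqP M00] := valP M.
have /andP[/eqP N10 /eqP N00] := valP N.
rewrite /C2_trace_fun !mxE !big_ord_recl !big_ord0 /=.
have -> : lift ord0 ord0 = 1 :> 'I_2 by apply/val_inj.
by rewrite M10 N10 M00 N00; ring.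
Qed.

Definition C2_trace (alpha beta : F) : trace_on C2 :=
  TraceOn (C2_trace_funC alpha beta).
End C2.

Section Generators.
Variable F : fieldType.
Let x1 := var F 0.
Let x2 := var F 1.
Let x3 := var F 2.

Definition f1 : trace_poly F := x1 * x2 - x2 * x1.

Definition h2 : trace_poly F :=
  Tr x1 * Tr x2 * x3 - Tr x2 * Tr x3 * x1
    + Tr (x1 * x2) * Tr x3 - Tr (x2 * x3) * Tr x1.

Definition h3 : trace_poly F :=
  - Tr (x1 * x2) * x3 - Tr (x1 * x3) * x2 - Tr (x2 * x3) * x1
    + Tr (x1 * x2 * x3)
    + Tr x1 * x2 * x3 + Tr x2 * x1 * x3 + Tr x3 * x1 * x2.
End Generators.

(* Main.v *)
Require Import Defs.
From HB Require Import structures.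
From mathcomp Require Import all_boot all_order all_algebra.
From mathcomp Require Import generic_quotient ring_quotient finmap ring boolp.
Import GRing.Theory.
Set Implicit Arguments.
Unset Strict Implicit.
Unset Printing Implicit Defensive.
Local Open Scope ring_scope.
Local Open Scope quotient_scope.

(** An element of C_2 is a dual number a + b e with e^2 = 0, and the trace
    considered here is its coordinate b. Two facts carry the proof.

    Reduction. Put eps_ij = Tr(x_i) x_j + Tr(x_j) x_i - Tr(x_i x_j), whose value
    in C_2 is 2 b_i b_j e. In terms of eps, the polynomial h_2 says
      Tr(x_1) eps_23 = Tr(x_3) eps_12,
    and h_3 says that the trace of a product of three factors is a combination
    of traces of shorter products. Let I be the trace T-ideal generated by f_1,
    h_2 and h_3. Modulo I all trace polynomials commute and are polynomials in
    the x_i, the Tr(x_i) and the eps_ij; moreover eps_ij eps_kl = 0, because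
    h_2 at (x_i x_j, x_k, x_l), after the elimination of Tr(x_i x_j x_k) by h_3,
    is a combination of instances of h_2 in the variables and of that product.
    So modulo I every trace polynomial is a linear combination of normal forms
    of two kinds,
      Tr(x)^beta x^alpha   and   eps_ij Tr(x)^gamma x^alpha,
    and a normal form of the second kind depends only on alpha and on the
    multiset beta = gamma + {i, j} ([eps_prod_perm], [nf_span_tr],
    [monom_nf_span]).

    Separation. At x_i = a_i + b_i e the first coordinate of a normal form is
    b^beta a^alpha for the first kind and 0 for the second kind, and the second
    coordinate of a normal form of the second kind is 2 b^beta a^alpha. If a
    combination of normal forms is an identity of C_2, its first coordinate
    shows that the part of the first kind vanishes, and then its second
    coordinate does the same for the second kind. To pass from the vanishing of
    values to the vanishing of coefficients, let the a_i and b_i be the j-th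
    powers of distinct primes: b^beta a^alpha becomes the j-th power of an
    integer which determines alpha and beta, so a combination that vanishes for
    all j has only zero power moments, and interpolation shows that it is zero
    ([moments_vanish], [normal_form_separation]). Characteristic zero keeps
    distinct integers distinct and makes 2 invertible.

    Conversely I consists of identities: the identities of an algebra whose
    trace kills 1 form a trace T-ideal ([trace_identities_T_ideal]), and the
    generators are checked in coordinates.

    The multilinear normal forms in n variables are indexed by the subsets beta
    of the variables for the first kind, and by the subsets with at least two
    elements for the second kind. They form a basis modulo the identities, so
    the codimension is 2^n + (2^n - n - 1) ([multilinear_quotient_dim]). *)

(** * Quotients by ideals containing all commutators *)

Section CommutativeQuotient.
Variables (R : nzRingType) (I : R -> Prop).
Hypotheses (I0 : I 0) (ID : forall f g, I f -> I g -> I (f + g)).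
Hypotheses (IMl : forall h f, I f -> I (h * f)).
Hypotheses (IMr : forall h f, I f -> I (f * h)).
Hypotheses (Icomm : forall f g, I (f * g - g * f)) (I1 : ~ I 1).

Let Ib : {pred R} := fun f => `[< I f >].

Let IbP f : reflect (I f) (f \in Ib). Proof. exact: asboolP. Qed.

Fact comm_quotient_zmod_closed : zmod_closed Ib.
Proof.
split=> [|f g /IbP If /IbP Ig]; apply/IbP => //.
by apply: ID => //; rewrite -mulN1r; apply: IMl.
Qed.

HB.instance Definition _ := GRing.isZmodClosed.Build R Ib
  comm_quotient_zmod_closed.

Let Q := Quotient.quot Ib.
HB.instance Definition _ := Choice.on Q.
HB.instance Definition _ := GRing.Zmodule.on Q.
HB.instance Definition _ := EqQuotient.on Q.
Let one : Q := \pi_Q 1.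
Let mul (x y : Q) : Q := \pi_Q (repr x * repr y).

Let eqQP (f g : R) : reflect (I (f - g)) (\pi_Q f == \pi_Q g).
Proof. by rewrite -Quotient.idealrBE; apply: IbP. Qed.

Let piM (f g : R) : \pi_Q (f * g) = mul (\pi_Q f) (\pi_Q g).
Proof.
rewrite /mul; apply/eqP/eqQP.
have /eqQP If : \pi_Q f == \pi_Q (repr (\pi_Q f)) by rewrite reprK.
have /eqQP Ig : \pi_Q g == \pi_Q (repr (\pi_Q g)) by rewrite reprK.
set f' := repr _ in If *; set g' := repr _ in Ig *.
have -> : f * g - f' * g' = (f - f') * g + f' * (g - g').
  by rewrite mulrBl mulrBr addrA subrK.
by apply: ID; [apply: IMr | apply: IMl].
Qed.

Let mulA : associative mul.
Proof.
elim/quotW=> f; elim/quotW=> g; elim/quotW=> h.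
by rewrite -(piM g h) -(piM f g) -(piM f (g * h)) -(piM (f * g) h) mulrA.
Qed.

Let mulC : commutative mul.
Proof.
elim/quotW=> f; elim/quotW=> g; rewrite -(piM f g) -(piM g f).
exact/eqP/eqQP.
Qed.

Let mul1 : left_id one mul.
Proof. by elim/quotW=> f; rewrite -(piM 1 f) mul1r. Qed.

Let mulD : left_distributive mul +%R.
Proof.
elim/quotW=> f; elim/quotW=> g; elim/quotW=> h.
rewrite -(raddfD \pi_Q f g) -(piM (f + g) h) -(piM f h) -(piM g h).
by rewrite mulrDl raddfD.
Qed.

Let one_neq0 : one != 0.
Proof.
by rewrite /one -(raddf0 \pi_Q); apply/eqQP; rewrite subr0.
Qed.

HB.instance Definition _ := GRing.Zmodule_isComNzRing.Build Q
  mulA mulC mul1 mulD one_neq0.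

Let pi (f : R) : Q := \pi_Q f.

Let pi_zmod : zmod_morphism pi.
Proof. exact: raddfB. Qed.

Let pi_monoid : monoid_morphism pi.
Proof. by split=> // f g; apply: piM. Qed.

HB.instance Definition _ := GRing.isZmodMorphism.Build R Q pi pi_zmod.
HB.instance Definition _ := GRing.isMonoidMorphism.Build R Q pi pi_monoid.

(** Computations modulo an ideal that contains all commutators may be carried
    out in a commutative ring. *)
Lemma comm_quotient : exists (C : comNzRingType) (p : {rmorphism R -> C}),
  forall f, p f = 0 <-> I f.
Proof.
exists Q, pi => f.
rewrite -(raddf0 \pi_Q); split=> [/eqP/eqQP|If]; first by rewrite subr0.
by apply/eqP/eqQP; rewrite subr0.
Qed.
End CommutativeQuotient.

(** * Linear combinations with vanishing power moments *)

Section Moments.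
Variables (F : fieldType) (Q : comNzRingType) (scal : {rmorphism F -> Q}).
Variables (K : eqType) (chi : K -> F) (N : K -> Q).
Hypothesis N_chi : forall k k', chi k = chi k' -> N k = N k'.

(** Lagrange interpolation, one point at a time. The correcting polynomial V
    vanishes at the earlier points; its value at the new point comes from a
    nonzero element of the field, hence is invertible in Q even though Q itself
    is only a ring. *)
Lemma interpolation (L : seq K) :
  exists P : {poly Q}, {in L, forall k, P.[scal (chi k)] = N k}.
Proof.
elim: L => [|k L [P PL]]; first by exists 0.
have [/mapP[k' k'L chi_kk'] | chi_new] := boolP (chi k \in map chi L).
  exists P => k''; rewrite inE => /predU1P[->|]; last exact: PL.
  by rewrite chi_kk' PL // (N_chi chi_kk').
pose d := \prod_(l <- L) (chi k - chi l).
have d_neq0 : d != 0.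
  rewrite prodf_seq_neq0; apply/allP => l lL /=; rewrite subr_eq0.
  by apply: contraNneq chi_new => ->; apply: map_f.
pose V := \prod_(l <- L) ('X - (scal (chi l))%:P).
have V_E x : V.[scal x] = scal (\prod_(l <- L) (x - chi l)).
  rewrite horner_prod rmorph_prod; apply: eq_bigr => l _.
  by rewrite !hornerE rmorphB.
exists (P + ((N k - P.[scal (chi k)]) * scal d^-1) *: V) => l.
rewrite inE hornerD hornerZ V_E => /predU1P[->|lL].
  by rewrite -mulrA -rmorphM mulVf // rmorph1 mulr1 addrC subrK.
have -> : \prod_(m <- L) (chi l - chi m) = 0.
  by apply/eqP; rewrite prodf_seq_eq0; apply/hasP; exists l; rewrite //= subrr.
by rewrite rmorph0 mulr0 addr0 PL.
Qed.

(** On finitely many points N is a polynomial in chi, and all the monomials of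
    that polynomial contribute moments, which are zero. *)
Lemma moments_vanish (L : seq (F * K)) :
    (forall j, \sum_(x <- L) x.1 * chi x.2 ^+ j = 0) ->
  \sum_(x <- L) scal x.1 * N x.2 = 0.
Proof.
move=> moment0; have [P PL] := interpolation (map snd L).
transitivity (\sum_(x <- L) scal x.1 * P.[scal (chi x.2)]).
  by apply: eq_big_seq => x xL; rewrite PL // map_f.
under eq_bigr do rewrite horner_coef mulr_sumr.
rewrite exchange_big big1 // => j _.
transitivity (P`_j * scal (\sum_(x <- L) x.1 * chi x.2 ^+ j)); last first.
  by rewrite moment0 rmorph0 mulr0.
rewrite rmorph_sum mulr_sumr.
by apply: eq_bigr => x _; rewrite mulrCA rmorphM rmorphXn.
Qed.
End Moments.

(** ** Multisets of letters coded by products of primes *)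

Section PrimeCodes.
Fixpoint prime_code (i : nat) : nat :=
  s2val (prime_above (if i is j.+1 then prime_code j else 0)).

Lemma prime_codeP i : prime (prime_code i).
Proof. by case: i => [|i] /=; case: prime_above. Qed.

Lemma prime_code_inj : injective prime_code.
Proof.
have lt_code : {homo prime_code : i j / (i < j)%N}.
  apply: homo_ltn => [|i]; first exact: ltn_trans.
  by rewrite [prime_code i.+1]/=; case: prime_above.
by move=> i j eq_ij; case: (ltngtP i j) => // /lt_code; rewrite eq_ij ltnn.
Qed.

(** Unique factorization: the exponent of the prime attached to a letter is the
    multiplicity of that letter. *)
Lemma prime_code_perm (s t : seq nat) :
  (\prod_(i <- s) prime_code i = \prod_(i <- t) prime_code i)%N -> perm_eq s t.
Proof.
have logE j u :
    (logn (prime_code j) (\prod_(i <- u) prime_code i))%N = count_mem j u.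
  elim: u => [|i u IHu]; first by rewrite big_nil logn1.
  have pos : (0 < \prod_(l <- u) prime_code l)%N.
    by rewrite prodn_gt0 // => l; apply/prime_gt0/prime_codeP.
  rewrite big_cons lognM ?(prime_gt0 (prime_codeP i)) // IHu /=; congr addn.
  by rewrite logn_prime ?prime_codeP // (inj_eq prime_code_inj) eq_sym.
by move=> eq_st; apply/allP => j _ /=; rewrite -!logE eq_st.
Qed.
End PrimeCodes.

(** * Arithmetic of trace polynomials *)

(** Reordering a product in a ring that is not commutative, when its factors
    commute with each other. *)
Lemma perm_big_comm (R : nzRingType) (J : eqType) (c : J -> R) (s t : seq J) :
    (forall i j, GRing.comm (c i) (c j)) -> perm_eq s t ->
  \prod_(i <- s) c i = \prod_(i <- t) c i.
Proof.
move=> comm_c; elim: s t => [|i s IHs] t.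
  by rewrite perm_sym => /perm_nilP->.
move=> st; have /rot_index tE : i \in t by rewrite -(perm_mem st) mem_head.
have : perm_eq s (drop (index i t).+1 t ++ take (index i t) t).
  by rewrite -(perm_cons i) -tE perm_sym perm_rot perm_sym.
move/IHs; rewrite big_cons => ->.
transitivity (\prod_(j <- rot (index i t) t) c j); first by rewrite tE big_cons.
rewrite /rot big_cat /=.
rewrite -[in RHS](cat_take_drop (index i t) t) big_cat /=.
by apply: commr_prod => j _; apply/commr_sym/commr_prod.
Qed.

Section TracePolynomials.
Variable F : fieldType.
Implicit Types (f h : trace_poly F) (t : tmonom) (c : F).

Lemma monom_mul t t' : << t >> * << t' >> = << mmul t t' >> :> trace_poly F.
Proof. by rewrite malgM_def fgmulUU mulr1. Qed.

Lemma monom_scale c t : << c *g t >> = c *: << t >> :> trace_poly F.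
Proof. by apply/malgP => t'; rewrite mcoeffZ !mcoeffU mulrnAr mulr1. Qed.

Lemma trace_polyE f : f = \sum_(t <- msupp f) f@_t *: << t >>.
Proof. by rewrite {1}[f]monalgE; apply: eq_bigr => t _; apply: monom_scale. Qed.

Lemma trace_poly_ind (P : trace_poly F -> Prop) :
    P 0 -> (forall f h, P f -> P h -> P (f + h)) ->
    (forall c t, P (c *: << t >>)) ->
  forall f, P f.
Proof. by move=> P0 PD PU f; rewrite [f]trace_polyE; apply: big_ind. Qed.

(** Evaluations are linear, so they are compared on basis elements. *)
Lemma trace_poly_linear_ext (V : lmodType F) (phi psi : trace_poly F -> V) :
    linear phi -> linear psi -> (forall t, phi << t >> = psi << t >>) ->
  phi =1 psi.
Proof.
move=> phiL psiL eq_monom.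
have linear0 chi : linear chi -> chi (0 : trace_poly F) = 0 :> V.
  move=> chiL; rewrite -[0](addNr (0 : trace_poly F)) -scaleN1r chiL.
  by rewrite scaleN1r addNr.
elim/trace_poly_ind => [|f h fE hE|c t]; first by rewrite !linear0.
  by rewrite -[f]scale1r phiL psiL fE hE.
by rewrite -[_ *: _]addr0 phiL psiL eq_monom !linear0.
Qed.

Lemma monom_mulZ c c' t t' :
  (c *: << t >>) * (c' *: << t' >>) = (c * c') *: << mmul t t' >>
    :> trace_poly F.
Proof. by rewrite -!monom_scale malgM_def fgmulUU. Qed.

Lemma trace_poly_scalerAr c f h : c *: (f * h) = f * (c *: h).
Proof.
elim/trace_poly_ind: f => [|f f' fE f'E|d t]; first by rewrite !mul0r scaler0.
  by rewrite !mulrDl scalerDr fE f'E.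
elim/trace_poly_ind: h => [|h h' hE h'E|d' t'].
- by rewrite scaler0 mulr0 scaler0.
- by rewrite scalerDr !mulrDr scalerDr hE h'E.
by rewrite scalerA !monom_mulZ scalerA mulrCA.
Qed.

Lemma scalar_central c f : GRing.comm (c%:A : trace_poly F) f.
Proof.
by rewrite /GRing.comm -trace_poly_scalerAr mulr1 -scalerAl mul1r.
Qed.

Lemma pure_central (m : {cmonom cyclic_word}) f :
  GRing.comm << TMonom m mone >> f.
Proof.
elim/trace_poly_ind: f => [|f h fE hE|c t]; first exact: commr0.
  exact: commrD.
rewrite /GRing.comm -trace_poly_scalerAr -scalerAl !monom_mul.
congr (_ *: << _ >>); case: t => a w.
by rewrite /mmul /= /tmmul /= mul1m mulm1 mulmC.
Qed.

Lemma tr_word_central w f : GRing.comm (tr_word F w) f.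
Proof.
rewrite /tr_word; case: insub => [u|]; first exact: pure_central.
exact/commr_sym/commr0.
Qed.

Lemma mmapZ_in_alg (B : lalgType F) (e : tmonom -> B) c f :
  mmap (in_alg B) e (c *: f) = c *: mmap (in_alg B) e f.
Proof.
rewrite (mmapEw (msuppZ_le c f)) mmapE scaler_sumr; apply: eq_bigr => t _.
by rewrite mcoeffZ /= -!scalerAl !mul1r scalerA.
Qed.

Fact Tr_is_linear : linear (@Tr F).
Proof.
by move=> c f h; rewrite /Tr raddfD; congr (_ + _); exact: mmapZ_in_alg.
Qed.
HB.instance Definition _ := GRing.isLinear.Build F (trace_poly F) (trace_poly F)
  _ (@Tr F) Tr_is_linear.

Lemma TrD f h : Tr (f + h) = Tr f + Tr h. Proof. exact: linearD. Qed.
Lemma TrZ c f : Tr (c *: f) = c *: Tr f. Proof. exact: linearZ. Qed.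

Lemma Tr_monom t :
  Tr << t >> = << TMonom (traces_of t) mone >> * tr_word F (word_of t).
Proof. by rewrite /Tr mmapU /= scale1r mul1r. Qed.

Lemma Tr_central f h : GRing.comm (Tr f) h.
Proof.
elim/trace_poly_ind: f => [|f f' fE f'E|c t].
- by rewrite linear0; apply/commr_sym/commr0.
- rewrite TrD.
  exact: (commr_sym (commrD (commr_sym fE) (commr_sym f'E))).
rewrite TrZ Tr_monom /GRing.comm -trace_poly_scalerAr -scalerAl.
congr (_ *: _); apply: commr_sym; apply: commrM; apply: commr_sym.
  exact: pure_central.
exact: tr_word_central.
Qed.

Lemma tr_word_rot k w : tr_word F (rot k w) = tr_word F w.
Proof.
rewrite /tr_word; case: insubP => [u rw_neq0 uE|]; last first.
  case: insubP => // v w_neq0 _.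
  by rewrite -size_eq0 size_rot size_eq0 (negPf w_neq0).
case: insubP => [v w_neq0 vE|]; last first.
  by rewrite -size_eq0 -(size_rot k) size_eq0 (negPf rw_neq0).
suff -> : \pi_cyclic_word u = \pi_cyclic_word v by [].
by apply/esym/eqP; rewrite piE; apply/rot_eqP; exists k; rewrite uE vE.
Qed.

(** The monomial with letters s, as an element indexed by a plain sequence:
    unlike [tr_word], it is meaningful for the empty sequence, where it is 1. *)
Definition words (s : seq nat) : trace_poly F := word F (FMonom s).

Lemma words_nil : words [::] = 1.
Proof. by rewrite /words -fmoneE. Qed.

Lemma tmmulE a b u v :
  mmul (TMonom a u) (TMonom b v) = TMonom (mmul a b) (mmul u v).
Proof. by []. Qed.

Lemma words_cat u v : words (u ++ v) = words u * words v.
Proof.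
rewrite /words /word monom_mul tmmulE mulm1.
by rewrite -(fmmulE (FMonom u) (FMonom v)).
Qed.

Lemma var_words i : var F i = words [:: i].
Proof. by rewrite /var fmuE. Qed.

Lemma words_prod s : words s = \prod_(i <- s) var F i.
Proof.
elim: s => [|i s IHs]; first by rewrite words_nil big_nil.
by rewrite big_cons -cat1s words_cat IHs var_words.
Qed.

Lemma monom_split m w :
  << TMonom m (FMonom w) >> = << TMonom m mone >> * words w.
Proof. by rewrite monom_mul tmmulE mulm1 mul1m. Qed.

Lemma Tr_words w : Tr (words w) = tr_word F w.
Proof. by rewrite Tr_monom mul1r. Qed.

Lemma TrC f h : Tr (f * h) = Tr (h * f).
Proof.
elim/trace_poly_ind: f => [|f f' fE f'E|c t].
- by rewrite mul0r mulr0.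
- by rewrite mulrDl mulrDr !TrD fE f'E.
elim/trace_poly_ind: h => [|h h' hE h'E|d t'].
- by rewrite mul0r mulr0.
- by rewrite mulrDl mulrDr !TrD hE h'E.
suff monom : Tr << mmul t t' >> = Tr << mmul t' t >> :> trace_poly F.
  rewrite (monom_mulZ c d) (monom_mulZ d c) (mulrC d c).
  by rewrite !TrZ monom.
case: t t' => [m u] [m' u'].
rewrite (tmmulE m m' u u') (tmmulE m' m u' u) (mulmC m' m).
rewrite (Tr_monom (TMonom _ (mmul u u'))) (Tr_monom (TMonom _ (mmul u' u))).
congr (_ * _); rewrite /word_of (fmM u u') (fmM u' u).
by rewrite -[in LHS](tr_word_rot (size u)) rot_size_cat.
Qed.
End TracePolynomials.

(** * Evaluation is multiplicative *)

Section EvaluationTheory.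
Variables (F : fieldType) (B : lalgType F) (tau : B -> B) (g : nat -> B).
Let E : trace_poly F -> B := eval_trace_poly tau g.

Fact eval_is_linear : linear (eval_trace_poly tau g).
Proof.
move=> c f h; rewrite /eval_trace_poly raddfD.
by congr (_ + _); exact: mmapZ_in_alg.
Qed.
HB.instance Definition _ := GRing.isLinear.Build F (trace_poly F) B
  _ (eval_trace_poly tau g) eval_is_linear.

Lemma eval_monom t : eval_trace_poly tau g << t >> = eval_tmonom tau g t.
Proof. by rewrite /eval_trace_poly mmapU /= scale1r mul1r. Qed.

Lemma eval_words w : E (words F w) = eval_word g w.
Proof.
by rewrite /E eval_monom /eval_tmonom /= mdom1 big_seq_fset0 mul1r.
Qed.

Lemma eval_var i : E (var F i) = g i.
Proof. by rewrite var_words eval_words /eval_word big_seq1. Qed.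

Hypothesis tau_central : forall a b, GRing.comm (tau a) b.
Hypothesis scal_central : forall (c : F) (b : B), GRing.comm (c%:A) b.

Let cz z := tau (eval_word g (val (repr (z : cyclic_word)))).

Let eval_traces (m : {cmonom cyclic_word}) : B :=
  \prod_(z <- finsupp m) cz z ^+ m z.

Let czX_comm z z' i j : GRing.comm (cz z ^+ i) (cz z' ^+ j).
Proof. exact/commrX/commr_sym/commrX/tau_central. Qed.

(** Enlarging the range of the product to a common support is what makes two
    products of powers of traces comparable factor by factor. *)
Let eval_tracesEw (m : {cmonom cyclic_word}) (d : {fset cyclic_word}) :
  (finsupp m `<=` d)%fset -> eval_traces m = \prod_(z <- d) cz z ^+ m z.
Proof.
move=> /fsubsetP sub_d.
transitivity (\prod_(z <- d | z \in finsupp m) cz z ^+ m z); last first.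
  rewrite big_mkcond; apply: eq_bigr => z _; rewrite -cmE_neq0.
  by case: eqP => //= ->.
rewrite -big_filter; apply: perm_big_comm => [z z'|]; first exact: czX_comm.
apply: uniq_perm => [||z]; rewrite ?filter_uniq ?fset_uniq //.
by rewrite mem_filter andb_idr //; apply: sub_d.
Qed.

Let eval_tracesM m m' :
  eval_traces (mmul m m') = eval_traces m * eval_traces m'.
Proof.
rewrite (eval_tracesEw (fsubsetUl (finsupp m) (finsupp m'))).
rewrite (eval_tracesEw (fsubsetUr (finsupp m) (finsupp m'))).
rewrite -prodrM_comm => [|z z' _ _]; last exact: czX_comm.
rewrite /eval_traces mdomD; apply: eq_bigr => z _.
by rewrite cmM exprD.
Qed.

Lemma eval_traces_central m b : GRing.comm (eval_traces m) b.
Proof.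
by apply/commr_sym/commr_prod => z _; apply/commrX/commr_sym/tau_central.
Qed.

Lemma eval_monomM t t' : E (<< t >> * << t' >>) = E << t >> * E << t' >>.
Proof.
case: t t' => [m u] [m' u'].
rewrite monom_mul tmmulE /E (eval_monom (TMonom _ (mmul u u'))).
rewrite (eval_monom (TMonom m u)) (eval_monom (TMonom m' u')) /eval_tmonom.
rewrite -![\prod_(z <- finsupp _) _]/(eval_traces _) eval_tracesM.
rewrite /eval_word fmM big_cat /= -!mulrA; congr (_ * _).
by rewrite mulrA eval_traces_central mulrA.
Qed.

Let E0 : E 0 = 0. Proof. exact: linear0. Qed.
Let ED f h : E (f + h) = E f + E h. Proof. exact: linearD. Qed.
Let EZ c f : E (c *: f) = c *: E f. Proof. exact: linearZ. Qed.

(** Both hypotheses are about centrality: of the scalars and of the values of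
    the trace. They let the trace part of the second factor move to the left of
    the word of the first one. *)
Lemma evalM f h : E (f * h) = E f * E h.
Proof.
elim/trace_poly_ind: f => [|f f' fE f'E|c t].
- by rewrite mul0r E0 mul0r.
- by rewrite mulrDl !ED fE f'E mulrDl.
elim/trace_poly_ind: h => [|h h' hE h'E|d t'].
- by rewrite mulr0 E0 mulr0.
- by rewrite mulrDr !ED hE h'E mulrDr.
rewrite -scalerAl -trace_poly_scalerAr !EZ eval_monomM.
rewrite -scalerAl; congr (_ *: _).
rewrite -mulr_algl -[d *: E _]mulr_algl !mulrA; congr (_ * _).
exact: scal_central.
Qed.

Lemma eval1 : E 1 = 1.
Proof. by rewrite -(words_nil F) eval_words /eval_word big_nil. Qed.

Hypothesis tauC : forall a b, tau (a * b) = tau (b * a).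

(** The representative chosen for a cyclic word is a rotation of the given word,
    and tau does not see rotations. *)
Lemma eval_tr_word w : w != [::] -> E (tr_word F w) = tau (eval_word g w).
Proof.
move=> w_neq0; rewrite /tr_word insubT /= /E eval_monom /eval_tmonom /=.
rewrite mdomU big_seq_fset1 cmU eqxx expr1 fm1 [eval_word g [::]]big_nil mulr1.
set u := Sub _ _.
have : rot_eq u (repr (\pi_cyclic_word u)).
  by apply/eqmodP; rewrite reprK.
move=> /rot_eqP[k <-]; rewrite /eval_word /rot big_cat tauC -big_cat.
by rewrite cat_take_drop.
Qed.
End EvaluationTheory.

(** * Trace identities form a trace T-ideal *)

Section Substitution.
Variables (F : fieldType) (g : nat -> trace_poly F).

Fact subst_is_linear : linear (subst g).
Proof. exact: eval_is_linear. Qed.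
HB.instance Definition _ := GRing.isLinear.Build F (trace_poly F) (trace_poly F)
  _ (subst g) subst_is_linear.

Lemma substD f h : subst g (f + h) = subst g f + subst g h.
Proof. exact: linearD. Qed.

Lemma substZ c f : subst g (c *: f) = c *: subst g f.
Proof. exact: linearZ. Qed.

Fact subst_is_monoid_morphism : monoid_morphism (subst g).
Proof.
split=> [|f h]; first exact: eval1.
apply: evalM => [a b|c b]; [exact: Tr_central | exact: scalar_central].
Qed.
HB.instance Definition _ := GRing.isMonoidMorphism.Build (trace_poly F)
  (trace_poly F) (subst g) subst_is_monoid_morphism.

Lemma subst_monom t : subst g << t >> = eval_tmonom (@Tr F) g t.
Proof. exact: eval_monom. Qed.

Lemma subst_var i : subst g (var F i) = g i.
Proof. exact: eval_var. Qed.

Lemma subst_Tr_words w : w != [::] ->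
  subst g (Tr (words F w)) = Tr (eval_word g w).
Proof. by rewrite Tr_words; apply: eval_tr_word; apply: TrC. Qed.
End Substitution.

Section TraceIdentities.
Variables (F : fieldType) (A : algType F) (tr : trace_on A).

Definition tr_eval (g : nat -> A) : trace_poly F -> A :=
  eval_trace_poly (fun a => (tr a)%:A) g.

Let trD a b : tr (a + b) = tr a + tr b. Proof. exact: linearD. Qed.
Let trZ c a : tr (c *: a) = c * tr a. Proof. exact: linearZ. Qed.

Section Evaluate.
Variable g : nat -> A.

Fact tr_eval_is_linear : linear (tr_eval g).
Proof. exact: eval_is_linear. Qed.
HB.instance Definition _ := GRing.isLinear.Build F (trace_poly F) A
  _ (tr_eval g) tr_eval_is_linear.

Let alg_central (c : F) (b : A) : GRing.comm (c%:A) b.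
Proof. by rewrite /GRing.comm mulr_algl mulr_algr. Qed.

Lemma tr_evalD f h : tr_eval g (f + h) = tr_eval g f + tr_eval g h.
Proof. exact: linearD. Qed.

Lemma tr_evalZ c f : tr_eval g (c *: f) = c *: tr_eval g f.
Proof. exact: linearZ. Qed.

Fact tr_eval_is_monoid_morphism : monoid_morphism (tr_eval g).
Proof.
split=> [|f h]; first exact: eval1.
by apply: evalM => [a b|c b]; apply: alg_central.
Qed.
HB.instance Definition _ := GRing.isMonoidMorphism.Build (trace_poly F)
  A (tr_eval g) tr_eval_is_monoid_morphism.

Lemma tr_eval_monom t :
  tr_eval g << t >> = eval_tmonom (fun a => (tr a)%:A) g t.
Proof. exact: eval_monom. Qed.

Lemma tr_eval_words w : tr_eval g (words F w) = eval_word g w.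
Proof. exact: eval_words. Qed.

Lemma tr_eval_var i : tr_eval g (var F i) = g i.
Proof. exact: eval_var. Qed.

Lemma tr_eval_tr_word w : w != [::] ->
  tr_eval g (tr_word F w) = (tr (eval_word g w))%:A.
Proof.
move=> w_neq0; apply: (eval_tr_word (tau := fun a => (tr a)%:A)) => // a b.
by rewrite trace_funC.
Qed.

Lemma tr_eval_pure m : exists c : F, tr_eval g << TMonom m mone >> = c%:A.
Proof.
rewrite tr_eval_monom /eval_tmonom fm1 [eval_word g [::]]big_nil mulr1.
apply: (big_ind (fun a : A => exists c : F, a = c%:A))
  => [|a b [c ->] [d ->]|z _].
- by exists 1; rewrite scale1r.
- by exists (c * d); rewrite -scalerAl mul1r scalerA.
elim: (m z) => [|k [c IHk]]; first by exists 1; rewrite scale1r.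
rewrite exprS IHk.
by eexists (_ * c); rewrite -scalerAl mul1r scalerA.
Qed.

Hypothesis tr1 : tr 1 = 0.

(** Evaluation commutes with the formal trace. On a pure trace monomial the
    formal trace is 0 by convention, and so is the trace of its value, a scalar,
    because tr 1 = 0. *)
Lemma tr_eval_Tr f : tr_eval g (Tr f) = (tr (tr_eval g f))%:A.
Proof.
apply: (trace_poly_linear_ext (phi := fun f => tr_eval g (Tr f))
  (psi := fun f => (tr (tr_eval g f))%:A)) => [c f1 f2|c f1 f2|t].
- by rewrite TrD TrZ tr_evalD tr_evalZ.
- by rewrite tr_evalD tr_evalZ trD trZ scalerDl -scalerA.
case: t => [m [w]].
rewrite (Tr_monom F (TMonom m (FMonom w))) (monom_split F m w).
rewrite -[traces_of _]/m -[fmonom_val (word_of _)]/w !rmorphM /= tr_eval_words.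
have [d ->] := tr_eval_pure m.
rewrite -!scalerAl !mul1r trZ -scalerA; congr (_ *: _).
case: (eqVneq w [::]) => [->|/tr_eval_tr_word//].
by rewrite /tr_word insubF // linear0 [eval_word g [::]]big_nil tr1 scale0r.
Qed.
End Evaluate.

Hypothesis tr1 : tr 1 = 0.

(** Since evaluation commutes with the formal trace, evaluating after a
    substitution amounts to evaluating at the values of the substituted
    polynomials. *)
Lemma tr_eval_subst g h f :
  tr_eval g (subst h f) = tr_eval (fun i => tr_eval g (h i)) f.
Proof.
have eval_wordM w : tr_eval g (eval_word h w) =
    eval_word (fun i => tr_eval g (h i)) w by rewrite /eval_word rmorph_prod.
apply: (trace_poly_linear_ext (phi := fun f => tr_eval g (subst h f))
  (psi := tr_eval (fun i => tr_eval g (h i)))) => [c f1 f2|c f1 f2|t].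
- by rewrite substD substZ tr_evalD tr_evalZ.
- by rewrite tr_evalD tr_evalZ.
rewrite subst_monom tr_eval_monom /eval_tmonom rmorphM /= eval_wordM.
congr (_ * _); rewrite rmorph_prod; apply: eq_bigr => z _.
by rewrite rmorphXn /= tr_eval_Tr // eval_wordM.
Qed.

Lemma trace_identities_T_ideal : trace_T_ideal (trace_identity tr).
Proof.
have IdP f : trace_identity tr f <-> forall g, tr_eval g f = 0 by [].
split.
- by apply/IdP => g; rewrite linear0.
- move=> f f' /IdP If /IdP If'; apply/IdP => g.
  by rewrite tr_evalD If If' addr0.
- by move=> h f /IdP If; apply/IdP => g; rewrite rmorphM /= If mulr0.
- by move=> h f /IdP If; apply/IdP => g; rewrite rmorphM /= If mul0r.
- by move=> h _ f /IdP If; apply/IdP => g; rewrite tr_eval_subst If.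
- move=> w f _ /IdP If; apply/IdP => g.
  by rewrite tr_eval_Tr // rmorphM /= If mul0r linear0 scale0r.
- move=> f _ /IdP If; apply/IdP => g.
  by rewrite tr_eval_Tr // If linear0 scale0r.
Qed.
End TraceIdentities.

Section GeneratedIdeal.
Variables (F : fieldType) (S : trace_poly F -> Prop).

Lemma trace_T_ideal_gen_ideal : trace_T_ideal (trace_T_ideal_gen S).
Proof.
split.
- by move=> I [].
- by move=> f f' If If' I TI SI; apply: (TI_D TI); [apply: If|apply: If'].
- by move=> h f If I TI SI; apply: (TI_Ml TI); apply: If.
- by move=> h f If I TI SI; apply: (TI_Mr TI); apply: If.
- by move=> g gP f If I TI SI; apply: (TI_subst TI) => //; apply: If.
- by move=> w f w1 If I TI SI; apply: (TI_Tr_word TI) => //; apply: If.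
- by move=> f fP If I TI SI; apply: (TI_Tr TI) => //; apply: If.
Qed.
End GeneratedIdeal.

(** * Normal forms modulo the relations *)

(** The same expressions are needed in three rings: the trace polynomials, their
    quotient, and the algebra where they are evaluated. There X i stands for a
    variable and T w for the trace of a nonempty word. *)
Section NormalFormElements.
Variables (R : nzRingType) (X : nat -> R) (T : seq nat -> R).

Definition var_prod (w : seq nat) : R := \prod_(i <- w) X i.
Definition trace_prod (w : seq nat) : R := \prod_(i <- w) T [:: i].
(** In C_2 the value is twice the product of the traces of the two elements,
    times the nilpotent e. *)
Definition eps (i j : nat) : R :=
  T [:: i] * X j + T [:: j] * X i - T [:: i; j].

(** For s of size at least 2 this is meant as a function of the multiset of
    letters of s; that the choice of the two letters put into eps does not
    matter is [eps_prod_perm]. *)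
Definition eps_prod (s : seq nat) : R :=
  if s is [:: i, j & s'] then eps i j * trace_prod s' else 0.

(** A pair k of words stands for a pair of multisets of letters: k.1 are the
    letters inside traces, k.2 those outside. *)
Definition normal1 (k : seq nat * seq nat) : R := trace_prod k.1 * var_prod k.2.
Definition normal2 (k : seq nat * seq nat) : R := eps_prod k.1 * var_prod k.2.
End NormalFormElements.

Section NormalFormMorphism.
Variables (R S : nzRingType) (phi : {rmorphism R -> S}).
Variables (X : nat -> R) (T : seq nat -> R) (X' : nat -> S) (T' : seq nat -> S).
Hypotheses (phiX : forall i, phi (X i) = X' i).
Hypotheses (phiT : forall w, w != [::] -> phi (T w) = T' w).

Lemma rmorph_var_prod w : phi (var_prod X w) = var_prod X' w.
Proof. by rewrite rmorph_prod; apply: eq_bigr => i _; apply: phiX. Qed.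

Lemma rmorph_trace_prod w : phi (trace_prod T w) = trace_prod T' w.
Proof. by rewrite rmorph_prod; apply: eq_bigr => i _; apply: phiT. Qed.

Lemma rmorph_eps i j : phi (eps X T i j) = eps X' T' i j.
Proof. by rewrite /eps rmorphB rmorphD !rmorphM !phiX !phiT. Qed.

Lemma rmorph_normal1 k : phi (normal1 X T k) = normal1 X' T' k.
Proof. by rewrite /normal1 rmorphM rmorph_trace_prod rmorph_var_prod. Qed.

Lemma rmorph_normal2 k : phi (normal2 X T k) = normal2 X' T' k.
Proof.
rewrite /normal2 rmorphM rmorph_var_prod; congr (_ * _).
case: k => [[|i [|j s]] r] /=; rewrite ?rmorph0 //.
by rewrite rmorphM rmorph_eps rmorph_trace_prod.
Qed.
End NormalFormMorphism.

(** A commutative ring in which the consequences of h_2 and h_3 under the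
    substitution of words for the variables hold. *)
Section NormalForms.
Variables (F : fieldType) (Q : comNzRingType) (scal : {rmorphism F -> Q}).
Variables (X : nat -> Q) (T : seq nat -> Q).
Local Notation wX := (var_prod X).
Local Notation wT := (trace_prod T).
Local Notation e := (eps X T).
Local Notation eT := (eps_prod X T).
Local Notation nf1 := (normal1 X T).
Local Notation nf2 := (normal2 X T).

Hypothesis T_cyclic : forall u v, T (u ++ v) = T (v ++ u).
Hypothesis T_h2 : forall u v w, u != [::] -> v != [::] -> w != [::] ->
  T u * T v * wX w - T v * T w * wX u + T (u ++ v) * T w - T (v ++ w) * T u = 0.
Hypothesis T_h3 : forall u v w, u != [::] -> v != [::] -> w != [::] ->
  - T (u ++ v) * wX w - T (u ++ w) * wX v - T (v ++ w) * wX u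
    + T (u ++ v ++ w)
    + T u * wX v * wX w + T v * wX u * wX w + T w * wX u * wX v = 0.

Lemma var_prod1 i : wX [:: i] = X i. Proof. exact: big_seq1. Qed.
Lemma var_prod_cons i w : wX (i :: w) = X i * wX w. Proof. exact: big_cons. Qed.

Lemma trace_prod_cons i w : wT (i :: w) = T [:: i] * wT w.
Proof. exact: big_cons. Qed.

Lemma var_prod_perm u v : perm_eq u v -> wX u = wX v.
Proof. exact: perm_big. Qed.

Lemma trace_prod_perm u v : perm_eq u v -> wT u = wT v.
Proof. exact: perm_big. Qed.

Lemma epsC i j : e i j = e j i.
Proof. by rewrite /eps (T_cyclic [:: i] [:: j]); ring. Qed.

(** This is h_2 rewritten in terms of eps. *)
Lemma trace_eps_swap i j k : T [:: i] * e j k = T [:: k] * e i j.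
Proof.
apply/eqP; rewrite -subr_eq0.
rewrite -(T_h2 (u := [:: i]) (v := [:: j]) (w := [:: k])) //.
by rewrite /eps !var_prod1; apply/eqP; ring.
Qed.

Lemma T_split u v w : u != [::] -> v != [::] -> w != [::] ->
  T (u ++ v ++ w) =
    T (u ++ v) * wX w + T (u ++ w) * wX v + T (v ++ w) * wX u
    - T u * wX v * wX w - T v * wX u * wX w - T w * wX u * wX v.
Proof.
move=> u0 v0 w0; apply/eqP; rewrite -subr_eq0 -(T_h3 u0 v0 w0).
by apply/eqP; ring.
Qed.

(** With E(u, v) = T(u) v + T(v) u - T(uv), the relation h_2 for the words ij,
    k, l reads T(ij) E(k, l) = T(l) E(ij, k), while h_3 gives
      E(ij, k) = x_j eps_ik + x_i eps_jk.
    Substituting T(ij) = T(i) x_j + T(j) x_i - eps_ij leaves eps_ij eps_kl equal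
    to the combination below, which vanishes by [trace_eps_swap]. *)
Lemma eps_eps0 i j k l : e i j * e k l = 0.
Proof.
have H2 := T_h2 (u := [:: i; j]) (v := [:: k]) (w := [:: l]) isT isT isT.
have H3 := T_split (u := [:: i]) (v := [:: j]) (w := [:: k]) isT isT isT.
rewrite /= in H2 H3; rewrite H3 !var_prod1 var_prod_cons var_prod1 in H2.
have S1 := trace_eps_swap i k l; have S2 := trace_eps_swap j k l.
transitivity (X j * (T [:: i] * e k l - T [:: l] * e i k)
  + X i * (T [:: j] * e k l - T [:: l] * e j k)).
  apply/eqP; rewrite -subr_eq0 -oppr_eq0 -H2; apply/eqP; rewrite /eps.
  by ring.
by rewrite S1 S2 !subrr !mulr0 addr0.
Qed.

Lemma eps_prod_cons i s : (1 < size s)%N -> eT (i :: s) = T [:: i] * eT s.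
Proof.
case: s => [|j [|k s]] //= _.
by rewrite trace_prod_cons !mulrA (trace_eps_swap i) [T _ * _]mulrC.
Qed.

(** The relation [trace_eps_swap] exchanges a letter of eps with a letter inside
    a trace, and [epsC] exchanges the two letters of eps: first the tail is
    permuted while the head letter stays in place, then the head is exchanged
    with a letter of the tail. *)
Lemma eps_prod_perm s t : perm_eq s t -> eT s = eT t.
Proof.
have eT_tail i u v : perm_eq u v -> eT (i :: u) = eT (i :: v).
  case: u v => [|j u] [|j' v] uv //.
  - by move/perm_size: uv.
  - by move/perm_size: uv.
  have [jj' | ne_jj'] := eqVneq j j'.
    by rewrite jj' perm_cons in uv *; rewrite /= (trace_prod_perm uv).
  have /perm_to_rem u_j' : j' \in u.
    by move/perm_mem: uv => /(_ j'); rewrite !inE eqxx eq_sym (negPf ne_jj').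
  have v_j : perm_eq v (j :: rem j' u).
    rewrite -(perm_cons j') -(permPl uv); apply/seq.permP => a.
    by move/seq.permP: u_j' => /(_ a) /= ->; rewrite addnCA.
  rewrite /= (trace_prod_perm u_j') (trace_prod_perm v_j).
  rewrite !trace_prod_cons !mulrA.
  by rewrite ![e _ _ * _]mulrC (trace_eps_swap j' i j) (epsC j' i).
case: s t => [|i s] [|i' t] st //.
- by move/perm_size: st.
- by move/perm_size: st.
have [ii' | ne_ii'] := eqVneq i i'.
  by rewrite ii' perm_cons in st *; apply: eT_tail.
have /perm_to_rem s_i' : i' \in s.
  by move/perm_mem: st => /(_ i'); rewrite !inE eqxx eq_sym (negPf ne_ii').
have t_i : perm_eq t (i :: rem i' s).
  rewrite -(perm_cons i') -(permPl st); apply/seq.permP => a.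
  by move/seq.permP: s_i' => /(_ a) /= ->; rewrite addnCA.
by rewrite (eT_tail _ _ _ s_i') (eT_tail _ _ _ t_i) /= epsC.
Qed.

(** Combinations of normal forms of a fixed multidegree, given by the multiset
    of letters of w. *)
Inductive nf_span (w : seq nat) : Q -> Prop :=
| nf_span0 : nf_span w 0
| nf_span1 c k q : perm_eq (k.1 ++ k.2) w -> nf_span w q ->
    nf_span w (scal c * nf1 k + q)
| nf_span2 c k q : perm_eq (k.1 ++ k.2) w -> (1 < size k.1)%N -> nf_span w q ->
    nf_span w (scal c * nf2 k + q).

Lemma nf_spanD w p q : nf_span w p -> nf_span w q -> nf_span w (p + q).
Proof.
move=> wp wq; elim: wp => [|c k p' kw _ IHp|c k p' kw k1 _ IHp].
- by rewrite add0r.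
- by rewrite -addrA; apply: nf_span1.
- by rewrite -addrA; apply: nf_span2.
Qed.

Lemma nf_spanZ w c q : nf_span w q -> nf_span w (scal c * q).
Proof.
elim=> [|d k q' kw _ IHq|d k q' kw k1 _ IHq].
- by rewrite mulr0; exact: nf_span0.
- by rewrite mulrDr mulrA -rmorphM; apply: nf_span1.
- by rewrite mulrDr mulrA -rmorphM; apply: nf_span2.
Qed.

Lemma nf_spanN w q : nf_span w q -> nf_span w (- q).
Proof. by move/(nf_spanZ (-1)); rewrite rmorphN1 mulN1r. Qed.

Lemma nf_span_perm v w q : perm_eq v w -> nf_span v q -> nf_span w q.
Proof.
move=> vw; elim=> [|c k q' kv _ IHq|c k q' kv k1 _ IHq]; first exact: nf_span0.
- by apply: nf_span1 => //; apply: perm_trans vw.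
- by apply: nf_span2 => //; apply: perm_trans vw.
Qed.

Lemma nf_span_var i w q : nf_span w q -> nf_span (i :: w) (X i * q).
Proof.
elim=> [|c [s r] q' kw _ IHq|c [s r] q' kw k1 _ IHq].
- by rewrite mulr0; exact: nf_span0.
- have -> : X i * (scal c * nf1 (s, r) + q')
            = scal c * nf1 (s, i :: r) + X i * q'.
    by rewrite /normal1 /= var_prod_cons; ring.
  by apply: nf_span1 => //=; rewrite -cat1s perm_catCA perm_cons.
- have -> : X i * (scal c * nf2 (s, r) + q')
            = scal c * nf2 (s, i :: r) + X i * q'.
    by rewrite /normal2 /= var_prod_cons; ring.
  by apply: nf_span2 => //=; rewrite -cat1s perm_catCA perm_cons.
Qed.

Lemma nf_span_tr1 i w q : nf_span w q -> nf_span (i :: w) (T [:: i] * q).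
Proof.
elim=> [|c [s r] q' kw _ IHq|c [s r] q' kw k1 _ IHq].
- by rewrite mulr0; exact: nf_span0.
- have -> : T [:: i] * (scal c * nf1 (s, r) + q')
            = scal c * nf1 (i :: s, r) + T [:: i] * q'.
    by rewrite /normal1 /= trace_prod_cons; ring.
  by apply: nf_span1 => //=; rewrite perm_cons.
- have -> : T [:: i] * (scal c * nf2 (s, r) + q')
            = scal c * nf2 (i :: s, r) + T [:: i] * q'.
    by rewrite /normal2 [(_, _).1]/= eps_prod_cons //=; ring.
  by apply: nf_span2 => //=; rewrite ?perm_cons // ltnW.
Qed.

(** A second factor eps annihilates the normal forms of the second kind, so the
    span is stable. *)
Lemma nf_span_eps i j w q : nf_span w q -> nf_span [:: i, j & w] (e i j * q).
Proof.
elim=> [|c [s r] q' kw _ IHq|c [s r] q' kw k1 _ IHq].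
- by rewrite mulr0; exact: nf_span0.
- have -> : e i j * (scal c * nf1 (s, r) + q')
            = scal c * nf2 ([:: i, j & s], r) + e i j * q'.
    by rewrite /normal1 /normal2 /=; ring.
  by apply: nf_span2 => //=; rewrite !perm_cons.
- suff -> : e i j * (scal c * nf2 (s, r) + q') = e i j * q' by [].
  case: s k1 {kw} => [|k [|l s]] //= _.
  transitivity (e i j * e k l * (scal c * wT s * wX r) + e i j * q').
    by rewrite /normal2 /=; ring.
  by rewrite eps_eps0 mul0r add0r.
Qed.

Lemma nf_span_vars u w q : nf_span w q -> nf_span (u ++ w) (wX u * q).
Proof.
move=> wq; elim: u => [|i u IHu]; first by rewrite /var_prod big_nil mul1r.
by rewrite var_prod_cons -mulrA; apply: nf_span_var.
Qed.

(** Traces of single letters preserve the span, and so does the trace of two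
    letters, which is a combination of these and of eps. From three letters on,
    h_3 with two single letters as first factors lowers the length. *)
Lemma nf_span_tr u w q : u != [::] -> nf_span w q -> nf_span (u ++ w) (T u * q).
Proof.
have [n le_u_n] := ubnP (size u); elim: n => // n IHn in u w q le_u_n *.
case: u le_u_n => [|i [|j u]] // le_u_n _ wq; first exact: nf_span_tr1.
have T2 : nf_span [:: i, j & w] (T [:: i; j] * q).
  have -> : T [:: i; j] * q = X j * (T [:: i] * q) + X i * (T [:: j] * q)
                              - e i j * q by rewrite /eps; ring.
  apply: nf_spanD; last by apply/nf_spanN/nf_span_eps.
  apply: nf_spanD; last by apply/nf_span_var/nf_span_tr1.
  apply: (@nf_span_perm [:: j, i & w]); last by apply/nf_span_var/nf_span_tr1.
  exact/permPl/(perm_catCA [:: j] [:: i]).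
case: (eqVneq u [::]) => [-> //|u0] in le_u_n *.
have -> : T [:: i, j & u] * q =
    wX u * (T [:: i; j] * q) + X j * (T (i :: u) * q) + X i * (T (j :: u) * q)
    - wX u * (X j * (T [:: i] * q)) - wX u * (X i * (T [:: j] * q))
    - X i * (X j * (T u * q)).
  rewrite (T_split (u := [:: i]) (v := [:: j]) (w := u)) //= !var_prod1.
  by ring.
have permL : perm_eq (u ++ [:: i, j & w]) [:: i, j & u ++ w].
  exact/permPl/(perm_catCA u [:: i; j] w).
have permL' : perm_eq (u ++ [:: j, i & w]) [:: i, j & u ++ w].
  apply: (perm_trans (y := [:: j, i & u ++ w])).
    exact/permPl/(perm_catCA u [:: j; i] w).
  exact/permPl/(perm_catCA [:: j] [:: i]).
have permR : perm_eq [:: j, i & u ++ w] [:: i, j & u ++ w].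
  exact/permPl/(perm_catCA [:: j] [:: i]).
do !apply: nf_spanD; try apply: nf_spanN.
- exact/(nf_span_perm permL)/nf_span_vars.
- by apply/(nf_span_perm permR)/nf_span_var/(IHn (i :: u)).
- by apply/nf_span_var/(IHn (j :: u)).
- exact/(nf_span_perm permL')/nf_span_vars/nf_span_var/nf_span_tr1.
- exact/(nf_span_perm permL)/nf_span_vars/nf_span_var/nf_span_tr1.
- by apply/nf_span_var/nf_span_var/(IHn u) => //; apply: ltnW.
Qed.

Lemma nf_span_word u : nf_span u (wX u).
Proof.
rewrite -[wX u]addr0 -[wX u]mul1r -[1](rmorph1 scal).
have -> : wX u = nf1 ([::], u) by rewrite /normal1 /trace_prod big_nil mul1r.
by apply: nf_span1 => //; exact: nf_span0.
Qed.

(** The explicit form of a combination of normal forms; the multidegrees that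
    occur are restricted by P, so that general trace polynomials and multilinear
    ones are covered by the same statements. *)
Definition nf_sum (P : pred (seq nat)) (q : Q) : Prop :=
  exists C D : seq (F * (seq nat * seq nat)),
    [/\ all (fun x => P (x.2.1 ++ x.2.2)) C,
        all (fun x => P (x.2.1 ++ x.2.2) && (1 < size x.2.1)%N) D
      & q = \sum_(x <- C) scal x.1 * nf1 x.2
            + \sum_(x <- D) scal x.1 * nf2 x.2].

Lemma nf_sum0 P : nf_sum P 0.
Proof. by exists [::], [::]; rewrite !big_nil addr0. Qed.

Lemma nf_sumD P q q' : nf_sum P q -> nf_sum P q' -> nf_sum P (q + q').
Proof.
move=> [C [D [PC PD ->]]] [C' [D' [PC' PD' ->]]]; exists (C ++ C'), (D ++ D').
by rewrite !all_cat PC PD PC' PD' !big_cat /= addrACA.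
Qed.

Lemma nf_span_sum (P : pred (seq nat)) w q :
  (forall v, perm_eq v w -> P v) -> nf_span w q -> nf_sum P q.
Proof.
move=> Pw.
elim=> [|c k q' kw _ [C [D [PC PD ->]]]|c k q' kw k1 _ [C [D [PC PD ->]]]].
- exact: nf_sum0.
- by exists ((c, k) :: C), D; rewrite /= Pw // PC PD big_cons addrA.
- by exists C, ((c, k) :: D); rewrite /= Pw // k1 PC PD big_cons addrCA.
Qed.
End NormalForms.

(** * Separating normal forms by their values *)

Local Notation key := (seq nat * seq nat)%type.

(** Multilinear normal forms in n variables are indexed by the set of those
    variables which lie inside traces. *)
Section SetKeys.
Variable n : nat.

Definition set_key (S : {set 'I_n}) : key :=
  ([seq val i | i <- enum S], [seq val i | i <- enum (~: S)]).

Lemma mem_set_key1 S (i : 'I_n) : (val i \in (set_key S).1) = (i \in S).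
Proof. by rewrite mem_map ?mem_enum //; apply: val_inj. Qed.

Lemma mem_set_key2 S (i : 'I_n) : (val i \in (set_key S).2) = (i \notin S).
Proof. by rewrite mem_map ?mem_enum ?inE //; apply: val_inj. Qed.

Lemma set_key_full S : perm_eq ((set_key S).1 ++ (set_key S).2) (iota 0 n).
Proof.
rewrite /= -map_cat -val_enum_ord; apply: perm_map; apply: uniq_perm.
- rewrite cat_uniq !enum_uniq andbT; apply/hasPn => i.
  by rewrite !mem_enum inE.
- exact: enum_uniq.
by move=> i; rewrite mem_cat !mem_enum !inE orbN.
Qed.

Lemma set_keyP (k : key) : perm_eq (k.1 ++ k.2) (iota 0 n) ->
  exists S, perm_eq k.1 (set_key S).1 /\ perm_eq k.2 (set_key S).2.
Proof.
case: k => [s r] /= sr; exists [set i : 'I_n | val i \in s].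
have /[!cat_uniq]/and3P[s_uniq /hasPn s_r r_uniq] : uniq (s ++ r).
  by rewrite (perm_uniq sr) iota_uniq.
have mem_sr i : (i \in s) || (i \in r) = (i < n)%N.
  by rewrite -mem_cat (perm_mem sr) mem_iota.
split; apply: uniq_perm; rewrite // ?map_inj_uniq ?enum_uniq //;
  try exact: val_inj.
  move=> i; apply/idP/mapP => [i_s|[j]]; last by rewrite mem_enum inE => + ->.
  have lt_in : (i < n)%N by rewrite -mem_sr i_s.
  by exists (Ordinal lt_in); rewrite // mem_enum inE.
move=> i; apply/idP/mapP => [i_r|[j]].
  have lt_in : (i < n)%N by rewrite -mem_sr i_r orbT.
  by exists (Ordinal lt_in); rewrite // mem_enum !inE; apply: s_r.
rewrite mem_enum !inE => + ->; have := mem_sr j; rewrite ltn_ord.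
by case: (_ \in s).
Qed.

(** The point where a_i is 1 off S and 0 on S, and b_i is 1 - a_i, sees the
    normal forms of S only. *)
Lemma set_key_indicator (F : fieldType) (S S' : {set 'I_n}) :
  (\prod_(i <- (set_key S').1) (i \in (set_key S).1)%:R) *
  (\prod_(i <- (set_key S').2) (i \in (set_key S).2)%:R) = (S' == S)%:R :> F.
Proof.
rewrite !big_map.
have [->|ne_S] := eqVneq S' S.
  rewrite !big_seq !big1 ?mulr1 // => i; rewrite mem_enum ?inE => iS.
    by rewrite mem_set_key2 iS.
  by rewrite mem_set_key1 iS.
have [i iS] : exists i, (i \in S') != (i \in S).
  by apply/existsP; apply: contraNT ne_S => /existsPn eq_S; apply/eqP/setP => i;
     have := eq_S i; rewrite negbK => /eqP.
apply/eqP; rewrite mulf_eq0; apply/orP.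
have [iS'|iS'] := boolP (i \in S'); [left|right].
  rewrite prodf_seq_eq0; apply/hasP; exists i; rewrite ?mem_enum //=.
  by rewrite mem_set_key1; move: iS; rewrite iS'; case: (_ \in S);
    rewrite ?eqxx.
rewrite prodf_seq_eq0; apply/hasP; exists i; rewrite ?mem_enum ?inE //=.
by rewrite mem_set_key2; move: iS; rewrite (negPf iS'); case: (_ \in S);
  rewrite ?eqxx.
Qed.

Lemma card_index :
  #|{: {set 'I_n} + {S : {set 'I_n} | (1 < #|S|)%N}}| = (2 ^ n.+1 - n - 1)%N.
Proof.
have small : [set S : {set 'I_n} | (#|S| <= 1)%N]
           = set0 |: [set [set i] | i : 'I_n].
  apply/setP => S; rewrite !inE leq_eqVlt ltnS leqn0 cards_eq0 orbC.
  congr (_ || _); apply/cards1P/imsetP => [[i ->]|[i _ ->]]; last by exists i.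
  by exists i.
have card_small : #|[set S : {set 'I_n} | (#|S| <= 1)%N]| = n.+1.
  rewrite small cardsU1 card_imset ?card_ord; last exact: set1_inj.
  rewrite (_ : set0 \notin _) //; apply/imsetP => -[i _ /setP/(_ i)].
  by rewrite !inE eqxx.
rewrite card_sum card_sig.
have -> : #|[pred S : {set 'I_n} | (1 < #|S|)%N]| =
          #|~: [set S : {set 'I_n} | (#|S| <= 1)%N]|.
  by apply: eq_card => S; rewrite !inE ltnNge.
rewrite cardsCs setCK card_small -cardsT -powersetT card_powerset.
rewrite cardsT card_ord.
have := ltn_expl n (isT : 1 < 2)%N.
by rewrite expnS mul2n -addnn -subnDA addn1 => ?; rewrite addnBA.
Qed.
End SetKeys.

Section FiniteIndex.
Variables (F : fieldType) (V : lmodType F) (U W : V -> Prop).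

Lemma quotient_dim_fintype (K : finType) (b : K -> V) :
    (forall k, U (b k)) ->
    (forall u, U u -> exists c : K -> F, W (u - \sum_k c k *: b k)) ->
    (forall c : K -> F, W (\sum_k c k *: b k) -> forall k, c k = 0) ->
  quotient_dim U W #|K|.
Proof.
have sum_enum_val (h : K -> V) : \sum_k h k = \sum_(i < #|K|) h (enum_val i).
  by rewrite (reindex (@enum_val K K)) //; apply/onW_bij/enum_val_bij.
move=> Ub Uspan free.
exists (fun i => b (enum_val i)); split=> // [u Uu|c Wc i].
  have [c Wc] := Uspan u Uu; exists (fun i => c (enum_val i)).
  by rewrite -(sum_enum_val (fun k => c k *: b k)).
rewrite -[i]enum_valK; apply: (free (fun k => c (enum_rank k))).
suff -> : \sum_k c (enum_rank k) *: b k = \sum_i c i *: b (enum_val i) by [].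
rewrite (sum_enum_val (fun k => c (enum_rank k) *: b k)).
by apply: eq_bigr => j _; rewrite enum_valK.
Qed.
End FiniteIndex.

Section CharacteristicZero.
Variable F : fieldType.
Hypothesis charF0 : [pchar F] =i pred0.

Lemma natr_inj_pchar0 : injective (fun n : nat => n%:R : F).
Proof.
move=> m n /=; wlog le_mn : m n / (m <= n)%N => [IH | eq_mn].
  by case/orP: (leq_total m n) => le_mn eq_mn; [|apply/esym]; apply: IH.
apply/eqP; rewrite eqn_leq le_mn -subn_eq0 -(iffLR (pcharf0P F) charF0).
by rewrite natrB // eq_mn subrr eqxx.
Qed.

Lemma two_neq0 : 2%:R != 0 :> F.
Proof. by rewrite (iffLR (pcharf0P F) charF0). Qed.

(** Odd and even indices keep the letters inside traces apart from the letters
    outside. *)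
Definition code (k : key) : F :=
  (\prod_(i <- [seq i.*2.+1 | i <- k.1] ++ [seq i.*2 | i <- k.2])
     prime_code i)%N%:R.

Lemma code_inj k k' : code k = code k' -> perm_eq k.1 k'.1 /\ perm_eq k.2 k'.2.
Proof.
case: k k' => [s r] [s' r'] /natr_inj_pchar0 /prime_code_perm /= /seq.permP sr.
have odd_part a (u v : seq nat) :
    count [pred i | odd i & a i./2]
      ([seq i.*2.+1 | i <- u] ++ [seq i.*2 | i <- v])
    = count a u.
  rewrite count_cat !count_map -[RHS]addn0; congr addn.
    by apply: eq_count => i /=; rewrite odd_double uphalf_double.
  by rewrite -[RHS](count_pred0 v); apply: eq_count => i /=; rewrite odd_double.
have even_part a (u v : seq nat) :
    count [pred i | ~~ odd i & a i./2]
      ([seq i.*2.+1 | i <- u] ++ [seq i.*2 | i <- v])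
    = count a v.
  rewrite count_cat !count_map -[RHS]add0n; congr addn.
    rewrite -[RHS](count_pred0 u).
    by apply: eq_count => i /=; rewrite odd_double.
  by apply: eq_count => i /=; rewrite odd_double doubleK.
split; apply/seq.permP => a.
  by rewrite -(odd_part a s r) -(odd_part a s' r') sr.
by rewrite -(even_part a s r) -(even_part a s' r') sr.
Qed.

(** The monomial b^beta a^alpha, for beta and alpha the multisets of k. *)
Definition value (a b : nat -> F) (k : key) : F :=
  (\prod_(i <- k.1) b i) * (\prod_(i <- k.2) a i).

Lemma value_code j k :
  value (fun i => (prime_code i.*2)%:R ^+ j)
        (fun i => (prime_code i.*2.+1)%:R ^+ j) k = code k ^+ j.
Proof.
by rewrite /value !prodrXl -exprMn /code big_cat !big_map natrM !natr_prod.
Qed.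

(** V is the space of trace polynomials, p the projection onto the quotient, and
    re_at, im_at are the two coordinates of the value at the point with
    coordinates a and b; n1 and n2 lift the normal forms N1 and N2. *)
Section Separation.
Variables (Q : comNzRingType) (scal : {rmorphism F -> Q}) (V : lmodType F).
Variables (p : V -> Q) (n1 n2 : key -> V) (N1 N2 : key -> Q).
Variables (re_at im_at : (nat -> F) -> (nat -> F) -> V -> F).
Hypotheses (pD : forall u v, p (u + v) = p u + p v).
Hypotheses (pZ : forall c u, p (c *: u) = scal c * p u).
Hypotheses (re_at_scalar : forall a b, scalar (re_at a b)).
Hypotheses (im_at_scalar : forall a b, scalar (im_at a b)).
Hypotheses (re_at_n1 : forall a b k, re_at a b (n1 k) = value a b k).
Hypotheses (re_at_n2 : forall a b k, re_at a b (n2 k) = 0).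
Hypotheses (im_at_n2 : forall a b k, (1 < size k.1)%N ->
  im_at a b (n2 k) = 2%:R * value a b k).
Hypotheses (p_n1 : forall k, p (n1 k) = N1 k).
Hypotheses (p_n2 : forall k, p (n2 k) = N2 k).
Hypothesis N1_perm : forall k k',
  perm_eq k.1 k'.1 -> perm_eq k.2 k'.2 -> N1 k = N1 k'.
Hypothesis N2_perm : forall k k',
  perm_eq k.1 k'.1 -> perm_eq k.2 k'.2 -> N2 k = N2 k'.
Hypothesis p_kernel : forall v, p v = 0 ->
  forall a b, re_at a b v = 0 /\ im_at a b v = 0.

Definition comb (L : seq (F * key)) (n : key -> V) : V :=
  \sum_(x <- L) x.1 *: n x.2.

Let scalar_comb (phi : V -> F) L n : scalar phi ->
  phi (comb L n) = \sum_(x <- L) x.1 * phi (n x.2).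
Proof.
move=> phiL.
have phi0 : phi 0 = 0 by rewrite -[0](addNr 0) -scaleN1r phiL mulN1r addNr.
rewrite /comb; elim: L => [|x L IHL]; first by rewrite !big_nil phi0.
by rewrite !big_cons phiL IHL.
Qed.

Let scalarD (phi : V -> F) u v : scalar phi -> phi (u + v) = phi u + phi v.
Proof. by move=> phiL; rewrite -[u]scale1r phiL mul1r scale1r. Qed.

Let scalar0 (phi : V -> F) : scalar phi -> phi 0 = 0.
Proof. by move=> phiL; rewrite -[0](addNr 0) -scaleN1r phiL mulN1r addNr. Qed.

Let p0 : p 0 = 0.
Proof. by rewrite -(scale0r 0) pZ rmorph0 mul0r. Qed.

Lemma p_comb L n : p (comb L n) = \sum_(x <- L) scal x.1 * p (n x.2).
Proof.
rewrite /comb; elim: L => [|x L IHL]; first by rewrite !big_nil p0.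
by rewrite !big_cons pD pZ IHL.
Qed.

Let p_comb1 L : p (comb L n1) = \sum_(x <- L) scal x.1 * N1 x.2.
Proof. by rewrite p_comb; apply: eq_bigr => x _; rewrite p_n1. Qed.

Let p_comb2 L : p (comb L n2) = \sum_(x <- L) scal x.1 * N2 x.2.
Proof. by rewrite p_comb; apply: eq_bigr => x _; rewrite p_n2. Qed.

(** The point with coordinates the j-th powers of the primes turns the monomial
    of k into code k ^+ j, so the first coordinates are the moments of the
    coefficients of the first kind. Once this part is known to be zero in the
    quotient it contributes nothing to the second coordinates, which then give
    twice the moments of the coefficients of the second kind. *)
Lemma normal_form_separation u C D :
    all (fun x => 1 < size x.2.1)%N D ->
    p u = \sum_(x <- C) scal x.1 * N1 x.2 + \sum_(x <- D) scal x.1 * N2 x.2 ->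
    (forall a b, re_at a b u = 0 /\ im_at a b u = 0) ->
  p u = 0.
Proof.
move=> /allP D1 uE u0.
pose r := comb C n1 + comb D n2.
have pr : p (u - r) = 0.
  by rewrite pD -scaleN1r pZ rmorphN1 mulN1r pD p_comb1 p_comb2 uE subrr.
have r0 a b : re_at a b r = 0 /\ im_at a b r = 0.
  have [ru iu] := u0 a b; have [rr ir] := p_kernel pr a b.
  move: rr ir; rewrite addrC -scaleN1r re_at_scalar im_at_scalar ru iu.
  rewrite !addr0 !mulN1r.
  by move=> /eqP; rewrite oppr_eq0 => /eqP-> /eqP; rewrite oppr_eq0 => /eqP->.
have C0 : \sum_(x <- C) scal x.1 * N1 x.2 = 0.
  apply: (moments_vanish scal (chi := code)) => [k k' /code_inj[]|j].
    exact: N1_perm.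
  have [+ _] := r0 (fun i => (prime_code i.*2)%:R ^+ j)
                   (fun i => (prime_code i.*2.+1)%:R ^+ j).
  rewrite /r scalarD // !scalar_comb // => re_r0; apply: etrans _ re_r0.
  rewrite [X in _ = _ + X]big1 => [|x _]; last by rewrite re_at_n2 mulr0.
  by rewrite addr0; apply: eq_bigr => x _; rewrite re_at_n1 value_code.
rewrite uE C0 add0r.
apply: (moments_vanish scal (chi := code)) => [k k' /code_inj[]|j].
  exact: N2_perm.
apply: (mulfI two_neq0); rewrite mulr0.
have [_] := r0 (fun i => (prime_code i.*2)%:R ^+ j)
               (fun i => (prime_code i.*2.+1)%:R ^+ j).
have [_ iC] := p_kernel (etrans (p_comb1 C) C0)
  (fun i => (prime_code i.*2)%:R ^+ j) (fun i => (prime_code i.*2.+1)%:R ^+ j).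
rewrite /r scalarD // iC add0r scalar_comb // => im_r0.
apply: etrans _ im_r0; rewrite mulr_sumr.
by apply: eq_big_seq => x /D1 x1; rewrite im_at_n2 // value_code mulrCA.
Qed.

Section Codimension.
Variables (U W : V -> Prop) (n : nat).
Hypothesis W_ev : forall v,
  W v <-> forall a b, re_at a b v = 0 /\ im_at a b v = 0.

Let full (w : seq nat) : bool := perm_eq w (iota 0 n).

Hypothesis U_n1 : forall k, full (k.1 ++ k.2) -> U (n1 k).
Hypothesis U_n2 : forall k, full (k.1 ++ k.2) -> U (n2 k).
Hypothesis U_span : forall u, U u -> exists C D : seq (F * key),
  [/\ all (fun x => full (x.2.1 ++ x.2.2)) C,
      all (fun x => full (x.2.1 ++ x.2.2) && (1 < size x.2.1)%N) D
    & p u = \sum_(x <- C) scal x.1 * N1 x.2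
            + \sum_(x <- D) scal x.1 * N2 x.2].

Local Notation index := ({set 'I_n} + {S : {set 'I_n} | (1 < #|S|)%N})%type.

Let b (i : index) : V :=
  match i with inl A => n1 (set_key A) | inr A => n2 (set_key (val A)) end.

Let spanned (q : Q) := exists c : index -> F, q = \sum_i scal (c i) * p (b i).

Let spanned0 : spanned 0.
Proof.
by exists (fun=> 0); rewrite big1 // => i _; rewrite rmorph0 mul0r.
Qed.

Let spannedD q q' : spanned q -> spanned q' -> spanned (q + q').
Proof.
move=> [c ->] [c' ->]; exists (fun i => c i + c' i).
by rewrite -big_split; apply: eq_bigr => i _; rewrite rmorphD mulrDl.
Qed.

Let spanned_b c i : spanned (scal c * p (b i)).
Proof.
exists (fun j => if j == i then c else 0); rewrite (bigD1 i) //= eqxx.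
by rewrite big1 ?addr0 // => j /negPf->; rewrite rmorph0 mul0r.
Qed.

Let spanned_n1 c k : full (k.1 ++ k.2) -> spanned (scal c * N1 k).
Proof.
move=> /set_keyP[S [k1 k2]].
by rewrite (N1_perm k1 k2) -p_n1; apply: (spanned_b c (inl S)).
Qed.

Let spanned_n2 c k : full (k.1 ++ k.2) -> (1 < size k.1)%N ->
  spanned (scal c * N2 k).
Proof.
move=> /set_keyP[S [k1 k2]]; rewrite (perm_size k1) size_map -cardE => S1.
rewrite (N2_perm k1 k2) -p_n2.
exact: (spanned_b c (inr (exist _ S S1))).
Qed.

(** The values at the points of [set_key_indicator] isolate the coefficients:
    first those of the first kind, then those of the second kind. *)
Lemma multilinear_quotient_dim : quotient_dim U W (2 ^ n.+1 - n - 1).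
Proof.
rewrite -card_index; apply: (quotient_dim_fintype (b := b)).
- by case=> S; [apply: U_n1 | apply: U_n2]; apply: set_key_full.
- move=> u /U_span[C [D [/allP Cfull /allP Dfull uE]]].
  have [c cE] : spanned (p u).
    rewrite uE; apply: spannedD; rewrite big_seq.
      apply: big_ind => [||x /Cfull]; [exact: spanned0|exact: spannedD|].
      exact: spanned_n1.
    apply: big_ind => [||x /Dfull/andP[]]; [exact: spanned0|exact: spannedD|].
    exact: spanned_n2.
  exists c; apply/W_ev/p_kernel; rewrite pD -scaleN1r pZ rmorphN1 mulN1r cE.
  suff -> : p (\sum_i c i *: b i) = \sum_i scal (c i) * p (b i).
    by rewrite subrr.
  rewrite (big_morph p pD p0).
  by apply: eq_bigr => i _; apply: pZ.
- move=> c /W_ev W_c.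
  pose va (S : {set 'I_n}) i : F := (i \in (set_key S).2)%:R.
  pose vb (S : {set 'I_n}) i : F := (i \in (set_key S).1)%:R.
  have value_S S S' : value (va S) (vb S) (set_key S') = (S' == S)%:R.
    exact: set_key_indicator.
  have ev_sum phi : scalar phi ->
      phi (\sum_i c i *: b i) = \sum_i c i * phi (b i).
    move=> phiL.
    rewrite (big_morph phi (fun u v => scalarD u v phiL) (scalar0 phiL)).
    by apply: eq_bigr => i _; rewrite -[_ *: _]addr0 phiL scalar0 // addr0.
  have c1 S : c (inl S) = 0.
    have [+ _] := W_c (va S) (vb S); rewrite ev_sum // big_sumType /=.
    rewrite [X in _ + X]big1 ?addr0 => [|T _]; last by rewrite re_at_n2 mulr0.
    rewrite (bigD1 S) //= re_at_n1 value_S eqxx mulr1 big1 ?addr0 // => T T_S.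
    by rewrite re_at_n1 value_S (negPf T_S) mulr0.
  case=> [S|S]; first exact: c1.
  have [_] := W_c (va (val S)) (vb (val S)); rewrite ev_sum // big_sumType /=.
  rewrite big1 ?add0r => [|T _]; last by rewrite c1 mul0r.
  have size_key (T : {S : {set 'I_n} | (1 < #|S|)%N}) :
      (1 < size (set_key (val T)).1)%N.
    by rewrite size_map -cardE; apply: (valP T).
  rewrite (bigD1 S) //= im_at_n2; last exact: (size_key S).
  rewrite value_S eqxx mulr1 big1 ?addr0 => [|T T_S].
    by move/eqP; rewrite mulf_eq0 (negPf two_neq0) orbF => /eqP.
  rewrite im_at_n2; last exact: (size_key T).
  rewrite value_S -[_ == val S]/(T == S) (negPf T_S).
  by rewrite !mulr0.
Qed.
End Codimension.
End Separation.
End CharacteristicZero.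

(** * The algebra C_2 in coordinates *)

(** Images of the generators under a ring morphism, given the images of their
    constituents. These serve both for evaluation and for substitution. *)
Lemma rmorph_f1 (R S : nzRingType) (phi : {rmorphism R -> S}) (x1 x2 : R) :
  phi (x1 * x2 - x2 * x1) = phi x1 * phi x2 - phi x2 * phi x1.
Proof. by rewrite rmorphB !rmorphM. Qed.

Lemma rmorph_h2 (R S : nzRingType) (phi : {rmorphism R -> S})
    (t1 t2 t3 t12 t23 x1 x3 : R) (u1 u2 u3 u12 u23 y1 y3 : S) :
    phi t1 = u1 -> phi t2 = u2 -> phi t3 = u3 -> phi t12 = u12 ->
    phi t23 = u23 -> phi x1 = y1 -> phi x3 = y3 ->
  phi (t1 * t2 * x3 - t2 * t3 * x1 + t12 * t3 - t23 * t1) =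
  u1 * u2 * y3 - u2 * u3 * y1 + u12 * u3 - u23 * u1.
Proof.
by move=> <- <- <- <- <- <- <-; rewrite rmorphB rmorphD rmorphB !rmorphM.
Qed.

Lemma rmorph_h3 (R S : nzRingType) (phi : {rmorphism R -> S})
    (t1 t2 t3 t12 t13 t23 t123 x1 x2 x3 : R)
    (u1 u2 u3 u12 u13 u23 u123 y1 y2 y3 : S) :
    phi t1 = u1 -> phi t2 = u2 -> phi t3 = u3 -> phi t12 = u12 ->
    phi t13 = u13 -> phi t23 = u23 -> phi t123 = u123 ->
    phi x1 = y1 -> phi x2 = y2 -> phi x3 = y3 ->
  phi (- t12 * x3 - t13 * x2 - t23 * x1 + t123 + t1 * x2 * x3 + t2 * x1 * x3
       + t3 * x1 * x2) =
  - u12 * y3 - u13 * y2 - u23 * y1 + u123 + u1 * y2 * y3 + u2 * y1 * y3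
    + u3 * y1 * y2.
Proof.
move=> <- <- <- <- <- <- <- <- <- <-.
by rewrite !rmorphD !rmorphN !rmorphM rmorphN.
Qed.

Section C2Coordinates.
Variable F : fieldType.
Implicit Types M N : C2 F.

(** The coordinates of the dual number a + b e. *)
Definition re M : F := val M 0 0.
Definition im M : F := val M 0 1.

Lemma C2_ext M N : re M = re N -> im M = im N -> M = N.
Proof.
rewrite /re /im => eq_re eq_im; apply/val_inj/matrixP => i j.
have /andP[/eqP M10 /eqP M00] := valP M.
have /andP[/eqP N10 /eqP N00] := valP N.
have ord2 (k : 'I_2) : k = 0 \/ k = 1.
  by case: k => [[|[|k]] ltk] //; [left | right]; apply/val_inj.
case: (ord2 i) (ord2 j) => -> [] ->;
  rewrite /= in eq_re eq_im M10 M00 N10 N00 *.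
- exact: eq_re.
- exact: eq_im.
- by rewrite M10 N10.
- by rewrite -M00 -N00.
Qed.

Fact re_is_zmod_morphism : zmod_morphism re.
Proof. by move=> M N; rewrite /re !mxE. Qed.
HB.instance Definition _ := GRing.isZmodMorphism.Build (C2 F) F re
  re_is_zmod_morphism.

Fact re_is_monoid_morphism : monoid_morphism re.
Proof.
split=> [|M N]; first by rewrite /re !mxE.
have /andP[/eqP M10 /eqP M00] := valP M.
have /andP[/eqP N10 /eqP N00] := valP N.
rewrite /re !mxE !big_ord_recl !big_ord0 /=.
have -> : lift ord0 ord0 = 1 :> 'I_2 by apply/val_inj.
by rewrite N10; ring.
Qed.
HB.instance Definition _ := GRing.isMonoidMorphism.Build (C2 F) F re
  re_is_monoid_morphism.

Lemma re_alg c : re c%:A = c.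
Proof. by rewrite /re !mxE /= mulr1. Qed.

Fact im_is_linear : scalar im.
Proof. by move=> c M N; rewrite /im !mxE. Qed.
HB.instance Definition _ := GRing.isLinear.Build F (C2 F) F _ im im_is_linear.

Lemma im_alg c : im c%:A = 0.
Proof. by rewrite /im !mxE /= mulr0. Qed.

Lemma imM M N : im (M * N) = re M * im N + im M * re N.
Proof.
have /andP[/eqP M10 /eqP M00] := valP M.
have /andP[/eqP N10 /eqP N00] := valP N.
rewrite /re /im !mxE !big_ord_recl !big_ord0 /=.
have -> : lift ord0 ord0 = 1 :> 'I_2 by apply/val_inj.
by rewrite N00; ring.
Qed.

Lemma C2_traceE M : C2_trace (0 : F) 1 M = im M.
Proof. by rewrite /= /C2_trace_fun mul0r mul1r add0r. Qed.

Let reD M N : re (M + N) = re M + re N. Proof. exact: rmorphD. Qed.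
Let reN M : re (- M) = - re M. Proof. exact: rmorphN. Qed.
Let reM M N : re (M * N) = re M * re N. Proof. exact: rmorphM. Qed.
Let imD M N : im (M + N) = im M + im N. Proof. exact: linearD. Qed.
Let imN M : im (- M) = - im M. Proof. exact: linearN. Qed.

Definition C2E := (reD, reN, reM, re_alg, imD, imN, imM, im_alg).

Definition C2_mx (a b : F) : 'M[F]_2 :=
  \matrix_(i, j) (if i == j then a else if i == 0 then b else 0).

Fact C2_mxP a b : C2_mx a b \in @C2_pred F.
Proof. by rewrite -topredE /= /C2_pred !mxE /= !eqxx. Qed.

Definition C2_elt a b : C2 F := MkC2 (C2_mxP a b).

Lemma re_elt a b : re (C2_elt a b) = a.
Proof. by rewrite /re mxE. Qed.

Lemma im_elt a b : im (C2_elt a b) = b.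
Proof. by rewrite /im mxE. Qed.
End C2Coordinates.

Section C2Identities.
Variable F : fieldType.
Let t := C2_trace (0 : F) 1.
Implicit Types (g : nat -> C2 F) (f : trace_poly F).

Lemma C2_trace1 : t 1 = 0.
Proof. by rewrite C2_traceE -(scale1r 1) im_alg. Qed.

Lemma C2_Tr g f : tr_eval t g (Tr f) = (im (tr_eval t g f))%:A.
Proof. by rewrite (tr_eval_Tr _ C2_trace1) C2_traceE. Qed.

Lemma C2_identity_f1 : trace_identity t (f1 F).
Proof.
move=> g; change (tr_eval t g (f1 F) = 0); rewrite /f1.
rewrite rmorph_f1 /= (tr_eval_var t g 0) (tr_eval_var t g 1).
apply: C2_ext; rewrite ?rmorph_f1 ?rmorph0 ?linear0; first by ring.
by rewrite !C2E; ring.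
Qed.

Let Tr1 g i : tr_eval t g (Tr (var F i)) = (im (g i))%:A.
Proof. by rewrite C2_Tr tr_eval_var. Qed.

Let Tr2 g i j : tr_eval t g (Tr (var F i * var F j)) = (im (g i * g j))%:A.
Proof. by rewrite C2_Tr rmorphM /= !tr_eval_var. Qed.

Let Tr3 g i j k :
  tr_eval t g (Tr (var F i * var F j * var F k)) = (im (g i * g j * g k))%:A.
Proof. by rewrite C2_Tr !rmorphM /= !tr_eval_var. Qed.

Lemma C2_identity_h2 : trace_identity t (h2 F).
Proof.
move=> g; apply: (etrans (rmorph_h2 (phi := tr_eval t g)
  (Tr1 g 0) (Tr1 g 1) (Tr1 g 2) (Tr2 g 0 1) (Tr2 g 1 2)
  (tr_eval_var t g 0) (tr_eval_var t g 2))).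
apply: C2_ext; rewrite ?rmorph0 ?linear0.
  by rewrite !C2E; ring.
by rewrite !C2E; ring.
Qed.

Lemma C2_identity_h3 : trace_identity t (h3 F).
Proof.
move=> g; apply: (etrans (rmorph_h3 (phi := tr_eval t g)
  (Tr1 g 0) (Tr1 g 1) (Tr1 g 2) (Tr2 g 0 1) (Tr2 g 0 2) (Tr2 g 1 2)
  (Tr3 g 0 1 2)
  (tr_eval_var t g 0) (tr_eval_var t g 1) (tr_eval_var t g 2))).
apply: C2_ext; rewrite ?rmorph0 ?linear0.
  by rewrite !C2E; ring.
by rewrite !C2E; ring.
Qed.
End C2Identities.

(** * Relations modulo the generated ideal *)

(** Scalars and traces being central, commutators of trace monomials reduce to
    commutators of words. *)
Lemma central_commutator (R : nzRingType) (p p' u u' : R) :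
    (forall r, GRing.comm p r) -> (forall r, GRing.comm p' r) ->
  (p * u) * (p' * u') - (p' * u') * (p * u) = (p * p') * (u * u' - u' * u).
Proof.
move=> pC p'C; rewrite mulrBr; congr (_ - _).
  by rewrite -!mulrA; congr (_ * _); rewrite [LHS]mulrA -p'C -mulrA.
by rewrite (pC p') -!mulrA; congr (_ * _); rewrite [LHS]mulrA -pC -mulrA.
Qed.

Section DegreeAndContent.
Implicit Types (m : {cmonom cyclic_word}) (u : {fmonom nat}).

Lemma deg_inM i t t' : deg_in i (mmul t t') = (deg_in i t + deg_in i t')%N.
Proof.
case: t t' => [m u] [m' u']; rewrite tmmulE /deg_in /= fmM count_cat.
rewrite addnACA; congr (_ + _)%N; rewrite mdomD.
rewrite (big_fset_incl _ (fsubsetUl (finsupp m) (finsupp m'))) /=; last first.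
  by move=> z _; rewrite -cmE_eq0 => /eqP->.
rewrite (big_fset_incl _ (fsubsetUr (finsupp m) (finsupp m'))) /=; last first.
  by move=> z _; rewrite -cmE_eq0 => /eqP->.
by rewrite -big_split; apply: eq_bigr => z _; rewrite cmM mulnDl.
Qed.

Lemma deg_in_word i w : deg_in i (TMonom mone (FMonom w)) = count_mem i w.
Proof. by rewrite /deg_in /= mdom1 big_seq_fset0. Qed.

Lemma deg_in_ucm i z :
  deg_in i (TMonom (ucm z) mone) = count_mem i (val (repr z)).
Proof. by rewrite /deg_in /= mdomU big_seq_fset1 cmU eqxx mul1n fm1 addn0. Qed.

Lemma cmonom_ind (P : {cmonom cyclic_word} -> Prop) :
  P mone -> (forall z m, P m -> P (mmul (ucm z) m)) -> forall m, P m.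
Proof.
move=> P1 PM m; have [n le_m_n] := ubnP (mdeg m).
elim: n => // n IHn in m le_m_n *.
have [->// | m_neq1] := eqVneq m mone.
have /fset0Pn[z z_m] : finsupp m != fset0.
  apply: contraNneq m_neq1 => m0; apply/eqP; apply: mdeg_eq0I.
  by rewrite mdegE m0 big_seq_fset0.
have mE : m = mmul (ucm z) (divcm m (ucm z)).
  apply/eqP/cmP => z'; rewrite cmM divcmE cmU.
  case: eqP => [<-|_]; last by rewrite subn0.
  by rewrite subnKC // lt0n cmE_neq0.
rewrite mE; apply/PM/IHn; move: le_m_n; rewrite {1}mE mdegM mdegU.
by rewrite add1n ltnS.
Qed.

Lemma tr_word_repr (K : fieldType) (z : cyclic_word) :
  tr_word K (val (repr z)) = << TMonom (ucm z) mone >>.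
Proof. by rewrite /tr_word valK reprK. Qed.

Lemma no_pure_words (K : fieldType) w : w != [::] -> no_pure_term (words K w).
Proof.
move=> w0 s; rewrite msuppU1 in_fset1 => /eqP-> /=.
by rewrite fmP fm1.
Qed.
End DegreeAndContent.

Definition C2_generators (F : fieldType) (h : trace_poly F) : Prop :=
  h = f1 F \/ h = h2 F \/ h = h3 F.

Section Relations.
Variable F : fieldType.

Let I := trace_T_ideal_gen (@C2_generators F).
Let TI : trace_T_ideal I := trace_T_ideal_gen_ideal (@C2_generators F).

Lemma gen_C2_identity f : I f -> trace_identity (C2_trace (0 : F) 1) f.
Proof.
move=> If; apply: If => [|h [->|[->|->]]].
- exact/trace_identities_T_ideal/C2_trace1.
- exact: C2_identity_f1.
- exact: C2_identity_h2.
- exact: C2_identity_h3.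
Qed.

Lemma gen_proper : ~ I 1.
Proof.
move/gen_C2_identity/(_ (fun=> 0)) => ev0.
have /eqP : tr_eval (C2_trace (0 : F) 1) (fun=> 0) 1 = 0 := ev0.
by rewrite rmorph1 oner_eq0.
Qed.

Let I_gen h : C2_generators h -> I h.
Proof. by move=> Gh J _; apply. Qed.

(* The generators involve three variables; the default value of nth serves for
   the third one and for all the others. *)
Let assign (u v w : seq nat) (i : nat) : trace_poly F :=
  words F (nth w [:: u; v] i).

Let assign_no_pure u v w :
    u != [::] -> v != [::] -> w != [::] ->
  forall i, no_pure_term (assign u v w i).
Proof.
by move=> u0 v0 w0 [|[|i]]; apply: no_pure_words; rewrite //= nth_nil.
Qed.

Lemma gen_words_comm u v :
  I (words F u * words F v - words F v * words F u).
Proof.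
have [->|u0] := eqVneq u [::].
  by rewrite words_nil mul1r mulr1 subrr; apply: (TI_0 TI).
have [->|v0] := eqVneq v [::].
  by rewrite words_nil mul1r mulr1 subrr; apply: (TI_0 TI).
have : I (subst (assign u v v) (f1 F)).
  apply: (TI_subst TI); first exact: assign_no_pure.
  by apply: I_gen; left.
by rewrite /f1 rmorph_f1 /= (subst_var _ 0) (subst_var _ 1).
Qed.

(** The relation f_1 holds for arbitrary words in place of the two variables,
    and the words determine all the commutators. *)
Lemma gen_comm f h : I (f * h - h * f).
Proof.
elim/trace_poly_ind: f => [|f f' fE f'E|c [m [u]]].
- by rewrite mul0r mulr0 subrr; apply: (TI_0 TI).
- rewrite mulrDl mulrDr opprD addrACA.
  exact: (TI_D TI).
elim/trace_poly_ind: h => [|h h' hE h'E|d [m' [u']]].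
- by rewrite mul0r mulr0 subrr; apply: (TI_0 TI).
- rewrite mulrDl mulrDr opprD addrACA.
  exact: (TI_D TI).
rewrite (monom_split F m u) (monom_split F m' u') !scalerAl central_commutator.
- by apply: (TI_Ml TI); apply: gen_words_comm.
- by move=> r; rewrite /GRing.comm -trace_poly_scalerAr -scalerAl pure_central.
- by move=> r; rewrite /GRing.comm -trace_poly_scalerAr -scalerAl pure_central.
Qed.

Section Quotient.
Variables (Q : comNzRingType) (p : {rmorphism trace_poly F -> Q}).
Hypothesis pP : forall f, p f = 0 <-> I f.

Definition class_var i := p (var F i).
Definition class_tr w := p (tr_word F w).

Local Notation class_word := (var_prod class_var).

Lemma p_words w : p (words F w) = class_word w.
Proof. by rewrite words_prod rmorph_prod. Qed.

Lemma class_tr_cyclic u v : class_tr (u ++ v) = class_tr (v ++ u).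
Proof. by rewrite /class_tr -(tr_word_rot _ (size u)) rot_size_cat. Qed.

Let assign_Tr u v w s : s != [::] ->
  subst (assign u v w) (Tr (words F s)) =
  tr_word F (flatten [seq nth w [:: u; v] i | i <- s]).
Proof.
move=> s0; rewrite subst_Tr_words // /eval_word -Tr_words; congr Tr.
elim: s {s0} => [|i s IHs]; first by rewrite big_nil words_nil.
by rewrite big_cons IHs /= words_cat.
Qed.

Let var2 i j : var F i * var F j = words F [:: i; j].
Proof. by rewrite -cat1s words_cat !var_words. Qed.

Let var3 i j k : var F i * var F j * var F k = words F [:: i; j; k].
Proof. by rewrite var2 var_words -words_cat. Qed.

Let s1 u v w i :
  subst (assign u v w) (Tr (var F i)) = tr_word F (nth w [:: u; v] i).
Proof. by rewrite var_words assign_Tr //= cats0. Qed.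

Let s2 u v w i j :
  subst (assign u v w) (Tr (var F i * var F j)) =
  tr_word F (nth w [:: u; v] i ++ nth w [:: u; v] j).
Proof. by rewrite var2 assign_Tr //= cats0. Qed.

Let s3 u v w i j k :
  subst (assign u v w) (Tr (var F i * var F j * var F k)) =
  tr_word F (nth w [:: u; v] i ++ nth w [:: u; v] j ++ nth w [:: u; v] k).
Proof. by rewrite var3 assign_Tr //= cats0. Qed.

Let s0 u v w i :
  subst (assign u v w) (var F i) = words F (nth w [:: u; v] i).
Proof. by rewrite subst_var. Qed.

Let subst_h2 u v w : subst (assign u v w) (h2 F) =
  tr_word F u * tr_word F v * words F w - tr_word F v * tr_word F w * words F u
  + tr_word F (u ++ v) * tr_word F w - tr_word F (v ++ w) * tr_word F u.
Proof.
rewrite /h2; apply: rmorph_h2.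
- exact: (s1 u v w 0).
- exact: (s1 u v w 1).
- exact: (s1 u v w 2).
- exact: (s2 u v w 0 1).
- exact: (s2 u v w 1 2).
- exact: (s0 u v w 0).
- exact: (s0 u v w 2).
Qed.

Let subst_h3 u v w : subst (assign u v w) (h3 F) =
  - tr_word F (u ++ v) * words F w - tr_word F (u ++ w) * words F v
  - tr_word F (v ++ w) * words F u + tr_word F (u ++ v ++ w)
  + tr_word F u * words F v * words F w + tr_word F v * words F u * words F w
  + tr_word F w * words F u * words F v.
Proof.
rewrite /h3; apply: rmorph_h3.
- exact: (s1 u v w 0).
- exact: (s1 u v w 1).
- exact: (s1 u v w 2).
- exact: (s2 u v w 0 1).
- exact: (s2 u v w 0 2).
- exact: (s2 u v w 1 2).
- exact: (s3 u v w 0 1 2).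
- exact: (s0 u v w 0).
- exact: (s0 u v w 1).
- exact: (s0 u v w 2).
Qed.

Lemma class_tr_h2 u v w : u != [::] -> v != [::] -> w != [::] ->
  class_tr u * class_tr v * class_word w
    - class_tr v * class_tr w * class_word u
    + class_tr (u ++ v) * class_tr w - class_tr (v ++ w) * class_tr u = 0.
Proof.
move=> u0 v0 w0.
have : I (subst (assign u v w) (h2 F)).
  apply: (TI_subst TI); first exact: assign_no_pure.
  by apply: I_gen; right; left.
rewrite subst_h2 => /pP <-; apply: esym.
by apply: rmorph_h2; rewrite ?p_words.
Qed.

Lemma class_tr_h3 u v w : u != [::] -> v != [::] -> w != [::] ->
  - class_tr (u ++ v) * class_word w - class_tr (u ++ w) * class_word v
    - class_tr (v ++ w) * class_word u + class_tr (u ++ v ++ w)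
    + class_tr u * class_word v * class_word w
    + class_tr v * class_word u * class_word w
    + class_tr w * class_word u * class_word v = 0.
Proof.
move=> u0 v0 w0.
have : I (subst (assign u v w) (h3 F)).
  apply: (TI_subst TI); first exact: assign_no_pure.
  by apply: I_gen; right; right.
rewrite subst_h3 => /pP <-; apply: esym.
by apply: rmorph_h3; rewrite ?p_words.
Qed.

Definition class_scalar : {rmorphism F -> Q} := p \o in_alg (trace_poly F).

Lemma p_scale c f : p (c *: f) = class_scalar c * p f.
Proof. by rewrite -[f in LHS]mul1r scalerAl rmorphM. Qed.

(** The traces of a monomial are multiplied one by one onto the normal form of
    its word, and the multidegree is kept along the way. *)
Lemma monom_nf_span m u : exists w,
  (forall i, count_mem i w = deg_in i (TMonom m (FMonom u))) /\
  nf_span class_scalar class_var class_tr w (p << TMonom m (FMonom u) >>).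
Proof.
elim/cmonom_ind: m => [|z m [w [w_deg w_span]]].
  exists u; split=> [i|]; first by rewrite deg_in_word.
  by rewrite -[<< _ >>]/(words F u) p_words; apply: nf_span_word.
have monomM : TMonom (mmul (ucm z) m) (FMonom u) =
    mmul (TMonom (ucm z) mone) (TMonom m (FMonom u)).
  by rewrite tmmulE mul1m.
exists (val (repr z) ++ w); split=> [i|].
  by rewrite count_cat monomM deg_inM deg_in_ucm w_deg.
rewrite monomM -monom_mul -tr_word_repr rmorphM.
exact: (nf_span_tr class_tr_h2 class_tr_h3 (valP (repr z)) w_span).
Qed.
End Quotient.
End Relations.

(** * Multidegrees of the normal forms *)

Section Homogeneous.
Variable F : fieldType.
Implicit Types (f h : trace_poly F) (d : nat -> nat).

Definition multihomog d f : Prop :=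
  forall s, s \in msupp f -> forall i, deg_in i s = d i.

Lemma multihomog0 d : multihomog d 0.
Proof. by move=> s; rewrite msupp0 in_fset0. Qed.

Lemma multihomogD d f h :
  multihomog d f -> multihomog d h -> multihomog d (f + h).
Proof.
move=> fd hd s /(fsubsetP (msuppD_le f h)); rewrite in_fsetU.
by case/orP; [apply: fd | apply: hd].
Qed.

Lemma multihomogN d f : multihomog d f -> multihomog d (- f).
Proof. by move=> fd s; rewrite msuppN; apply: fd. Qed.

Lemma multihomogM d d' f h : multihomog d f -> multihomog d' h ->
  multihomog (fun i => d i + d' i)%N (f * h).
Proof.
move=> fd hd s /msuppM_le[s1 [s2 [s1f s2h ->]]] i.
by rewrite deg_inM (fd _ s1f) (hd _ s2h).
Qed.

Lemma multihomog_ext d d' f : d =1 d' -> multihomog d f -> multihomog d' f.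
Proof. by move=> dd' fd s /fd s_deg i; rewrite s_deg dd'. Qed.

Local Notation counts w := (fun i => count_mem i w).

Lemma multihomog_words w : multihomog (counts w) (words F w).
Proof.
move=> s; rewrite /words /word msuppU1 in_fset1 => /eqP-> i.
exact: deg_in_word.
Qed.

Lemma multihomog_cat w w' f h : multihomog (counts w) f ->
  multihomog (counts w') h -> multihomog (counts (w ++ w')) (f * h).
Proof.
move=> fw hw'; apply: multihomog_ext (multihomogM fw hw') => i.
by rewrite count_cat.
Qed.

Lemma multihomog_perm w w' f : perm_eq w w' ->
  multihomog (counts w) f -> multihomog (counts w') f.
Proof. by move=> /seq.permP ww'; apply: multihomog_ext => i; apply: ww'. Qed.

Lemma multihomog_var i : multihomog (counts [:: i]) (var F i).
Proof. by rewrite var_words; apply: multihomog_words. Qed.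

Lemma multihomog_tr_word w : multihomog (counts w) (tr_word F w).
Proof.
rewrite /tr_word; case: insubP => [u _ uw|_]; last exact: multihomog0.
set z := \pi_cyclic_word u.
have /rot_eqP[k kE] : rot_eq u (repr z).
  by apply/eqmodP; rewrite reprK.
move=> s; rewrite msuppU1 in_fset1 => /eqP-> i; rewrite deg_in_ucm -kE uw.
have /seq.permP-> // : perm_eq (rot k w) w.
by rewrite perm_rot.
Qed.

Lemma multihomog_var_prod w : multihomog (counts w) (var_prod (var F) w).
Proof.
by rewrite /var_prod -words_prod; apply: multihomog_words.
Qed.

Lemma multihomog_trace_prod w :
  multihomog (counts w) (trace_prod (tr_word F) w).
Proof.
elim: w => [|i w IHw].
  by rewrite /trace_prod big_nil -words_nil; apply: multihomog_words.
rewrite /trace_prod big_cons -cat1s.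
by apply: multihomog_cat; first exact: multihomog_tr_word.
Qed.

Lemma multihomog_eps i j :
  multihomog (counts [:: i; j]) (eps (var F) (tr_word F) i j).
Proof.
apply: multihomogD; last exact/multihomogN/multihomog_tr_word.
apply: multihomogD.
  exact: (multihomog_cat (@multihomog_tr_word [:: i]) (@multihomog_var j)).
apply: (@multihomog_perm [:: j; i]).
  exact/permPl/(perm_catC [:: j] [:: i]).
exact: (multihomog_cat (@multihomog_tr_word [:: j]) (@multihomog_var i)).
Qed.

Lemma multihomog_normal1 k :
  multihomog (counts (k.1 ++ k.2)) (normal1 (var F) (tr_word F) k).
Proof.
exact: multihomog_cat (@multihomog_trace_prod _) (@multihomog_var_prod _).
Qed.

Lemma multihomog_normal2 k :
  multihomog (counts (k.1 ++ k.2)) (normal2 (var F) (tr_word F) k).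
Proof.
apply: multihomog_cat (@multihomog_var_prod _).
case: k.1 => [|i [|j s]]; try exact: multihomog0.
exact: (multihomog_cat (@multihomog_eps i j) (@multihomog_trace_prod s)).
Qed.

Lemma multihomog_multilinear n w f : perm_eq w (iota 0 n) ->
  multihomog (counts w) f -> multilinear n f.
Proof.
move=> /seq.permP wn fw s /fw s_deg i; rewrite s_deg wn.
by rewrite count_uniq_mem ?iota_uniq // mem_iota.
Qed.
End Homogeneous.

(** * Identities and codimensions of C_2 *)

Section Main.
Variable F : fieldType.
Let n1 : key -> trace_poly F := normal1 (var F) (tr_word F).
Let n2 : key -> trace_poly F := normal2 (var F) (tr_word F).

Let I := trace_T_ideal_gen (@C2_generators F).
Let TI : trace_T_ideal I := trace_T_ideal_gen_ideal (@C2_generators F).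
Let t := C2_trace (0 : F) 1.
Let Id := trace_identity t.

Let point (a b : nat -> F) (i : nat) : C2 F := C2_elt (a i) (b i).
Let ev a b : trace_poly F -> C2 F := tr_eval t (point a b).

Let tr_ev a b (w : seq nat) : C2 F := (im (eval_word (point a b) w))%:A.

Let ev_tr_word a b w : w != [::] -> ev a b (tr_word F w) = tr_ev a b w.
Proof. by move=> w0; rewrite /ev tr_eval_tr_word // C2_traceE. Qed.

Let ev_n1 a b k : ev a b (n1 k) = normal1 (point a b) (tr_ev a b) k.
Proof.
exact: (rmorph_normal1 (phi := tr_eval t (point a b))
  (tr_eval_var t _) (@ev_tr_word a b)).
Qed.

Let ev_n2 a b k : ev a b (n2 k) = normal2 (point a b) (tr_ev a b) k.
Proof.
exact: (rmorph_normal2 (phi := tr_eval t (point a b))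
  (tr_eval_var t _) (@ev_tr_word a b)).
Qed.

Let re_var_prod a b s : re (var_prod (point a b) s) = \prod_(i <- s) a i.
Proof.
by rewrite rmorph_prod; apply: eq_bigr => i _; apply: re_elt.
Qed.

Let re_trace_prod a b s : re (trace_prod (tr_ev a b) s) = \prod_(i <- s) b i.
Proof.
rewrite rmorph_prod; apply: eq_bigr => i _.
by rewrite /= /tr_ev re_alg /eval_word big_seq1 im_elt.
Qed.

Let eps_ev a b i j : eps (point a b) (tr_ev a b) i j
  = (b i)%:A * point a b j + (b j)%:A * point a b i
    - (a i * b j + b i * a j)%:A.
Proof.
rewrite /eps /tr_ev /eval_word !big_seq1 big_cons big_seq1.
by rewrite imM !im_elt !re_elt.
Qed.

Let re_eps a b i j : re (eps (point a b) (tr_ev a b) i j) = 0.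
Proof. by rewrite eps_ev !C2E !re_elt; ring. Qed.

Let im_eps a b i j : im (eps (point a b) (tr_ev a b) i j) = 2%:R * b i * b j.
Proof. by rewrite eps_ev !C2E !im_elt; ring. Qed.

Lemma re_ev_n1 a b k : re (ev a b (n1 k)) = value a b k.
Proof. by rewrite ev_n1 C2E re_trace_prod re_var_prod. Qed.

Let re_eps_prod a b s : re (eps_prod (point a b) (tr_ev a b) s) = 0.
Proof.
case: s => [|i [|j s]] /=; rewrite ?rmorph0 //.
by rewrite C2E re_eps mul0r.
Qed.

Lemma re_ev_n2 a b k : re (ev a b (n2 k)) = 0.
Proof. by rewrite ev_n2 C2E re_eps_prod mul0r. Qed.

Lemma im_ev_n2 a b k : (1 < size k.1)%N ->
  im (ev a b (n2 k)) = 2%:R * value a b k.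
Proof.
move=> k1; rewrite ev_n2 C2E re_eps_prod mul0r add0r re_var_prod.
rewrite /value mulrA; congr (_ * _).
case: k k1 => [[|i [|j s]] r] //= _.
by rewrite C2E re_eps mul0r add0r im_eps re_trace_prod !big_cons !mulrA.
Qed.

Definition re_at a b f := re (ev a b f).
Definition im_at a b f := im (ev a b f).

Lemma re_at_scalar a b : scalar (re_at a b).
Proof.
by move=> c f h; rewrite /re_at /ev tr_evalD tr_evalZ -mulr_algl !C2E.
Qed.

Lemma im_at_scalar a b : scalar (im_at a b).
Proof.
move=> c f h; rewrite /im_at /ev tr_evalD tr_evalZ -mulr_algl !C2E.
by rewrite mul0r addr0.
Qed.

(** A point of C_2 is given by its coordinates, so the identities are the trace
    polynomials all of whose values have zero coordinates. *)
Lemma Id_ev f : Id f <-> forall a b, re_at a b f = 0 /\ im_at a b f = 0.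
Proof.
split=> [If a b|rif g].
  have ev0 : ev a b f = 0 := If _.
  by rewrite /re_at /im_at ev0 rmorph0 linear0.
have -> : g = point (fun i => re (g i)) (fun i => im (g i)).
  by apply/funext => i; apply: C2_ext; rewrite ?re_elt ?im_elt.
have [r0 i0] := rif (fun i => re (g i)) (fun i => im (g i)).
by apply: C2_ext; [rewrite rmorph0|rewrite linear0].
Qed.

Section Quotient.
Variables (Q : comNzRingType) (p : {rmorphism trace_poly F -> Q}).
Hypothesis pP : forall f, p f = 0 <-> I f.
Hypothesis charF0 : [pchar F] =i pred0.

Let N1 := normal1 (class_var p) (class_tr p).
Let N2 := normal2 (class_var p) (class_tr p).

Lemma p_n1 k : p (n1 k) = N1 k.
Proof. exact: rmorph_normal1. Qed.

Lemma p_n2 k : p (n2 k) = N2 k.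
Proof. exact: rmorph_normal2. Qed.

Let N1_perm k k' : perm_eq k.1 k'.1 -> perm_eq k.2 k'.2 -> N1 k = N1 k'.
Proof.
move=> k1 k2.
by rewrite /N1 /normal1 (trace_prod_perm _ k1) (var_prod_perm _ k2).
Qed.

Let N2_perm k k' : perm_eq k.1 k'.1 -> perm_eq k.2 k'.2 -> N2 k = N2 k'.
Proof.
move=> k1 k2; rewrite /N2 /normal2 (var_prod_perm _ k2).
by rewrite (eps_prod_perm (class_tr_cyclic p) (class_tr_h2 pP) k1).
Qed.

Let pD f h : p (f + h) = p f + p h. Proof. exact: rmorphD. Qed.

Let pZ c f : p (c *: f) = class_scalar p c * p f. Proof. exact: p_scale. Qed.

Let kernel_ev h : p h = 0 -> forall a b, re_at a b h = 0 /\ im_at a b h = 0.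
Proof. by move/pP/gen_C2_identity/Id_ev. Qed.

Lemma p_nf_sum (P : pred (seq nat)) f :
    (forall s, s \in msupp f ->
       forall w, (forall i, count_mem i w = deg_in i s) -> P w) ->
  nf_sum (class_scalar p) (class_var p) (class_tr p) P (p f).
Proof.
move=> Pf; rewrite {1}[f]trace_polyE rmorph_sum big_seq.
apply: big_ind => [||[m [u]] s_f]; [exact: nf_sum0|exact: nf_sumD|].
rewrite p_scale; have [w [w_deg w_span]] := monom_nf_span pP m u.
apply: (nf_span_sum _ (nf_spanZ (f@_(TMonom m (FMonom u))) w_span)) => v vw.
by apply: (Pf _ s_f) => i; rewrite -w_deg; apply/seq.permP.
Qed.

Lemma C2_identity_in_kernel f : Id f -> p f = 0.
Proof.
move=> /Id_ev f0.
have [C [D [_ /allP D1 fE]]] := @p_nf_sum predT f (fun _ _ _ _ => isT).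
apply: (normal_form_separation charF0 pD pZ re_at_scalar im_at_scalar
  re_ev_n1 re_ev_n2 im_ev_n2 p_n1 p_n2 N1_perm N2_perm kernel_ev _ fE f0).
by apply/allP => x /D1/andP[].
Qed.

Lemma C2_codimension n : trace_codim t n (2 ^ n.+1 - n - 1).
Proof.
have n1_lin k : perm_eq (k.1 ++ k.2) (iota 0 n) -> multilinear n (n1 k).
  by move/multihomog_multilinear; apply; apply: multihomog_normal1.
have n2_lin k : perm_eq (k.1 ++ k.2) (iota 0 n) -> multilinear n (n2 k).
  by move/multihomog_multilinear; apply; apply: multihomog_normal2.
apply: (multilinear_quotient_dim charF0 pD pZ re_at_scalar im_at_scalar
  re_ev_n1 re_ev_n2 im_ev_n2 p_n1 p_n2 N1_perm N2_perm kernel_ev Id_ev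
  n1_lin n2_lin) => f f_lin.
apply: (p_nf_sum (P := fun w => perm_eq w (iota 0 n))).
move=> s /f_lin s_deg w w_deg.
apply/allP => i _ /=; rewrite w_deg s_deg count_uniq_mem ?iota_uniq //.
by rewrite mem_iota.
Qed.
End Quotient.

Lemma exists_quotient :
  exists (Q : comNzRingType) (p : {rmorphism trace_poly F -> Q}),
  forall f, p f = 0 <-> I f.
Proof.
apply: comm_quotient.
- exact: (TI_0 TI).
- exact: (TI_D TI).
- exact: (TI_Ml TI).
- exact: (TI_Mr TI).
- exact: gen_comm.
- exact: gen_proper.
Qed.

Hypothesis charF0 : [pchar F] =i pred0.

Lemma C2_identities_generated f : Id f <-> I f.
Proof.
have [Q [p pP]] := exists_quotient.
by split=> [/(C2_identity_in_kernel pP charF0)/pP|/gen_C2_identity].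
Qed.
End Main.

Theorem theorem20 (F : fieldType) (charF0 : [pchar F] =i pred0) :
  (forall f : trace_poly F,
     trace_identity (C2_trace (0 : F) 1) f <->
     trace_T_ideal_gen (fun h => h = f1 F \/ h = h2 F \/ h = h3 F) f)
  /\ (forall n : nat, (1 <= n)%N ->
        trace_codim (C2_trace (0 : F) 1) n (2 ^ n.+1 - n - 1)%N).
Proof.
split=> [f|n _]; first exact: C2_identities_generated.
have [Q [p pP]] := exists_quotient F.
exact: C2_codimension pP charF0 n.
Qed.
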